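(* For any $\vartheta\in\mathbb C$, the operators $T(z)=b(z)+\vartheta c(z)$, $z\in\mathbb C$, restricted to functions on the submanifold $S_1\subset\mathbb C^{n+1}$ given by the equation $\lambda+\sum_{i=1}^nx_i+\sum_{i=1}^nz_i=0$, form a commuting family: $T(z)T(w)=T(w)T(z)$ for all $z,w\in\mathbb C$.
   Context: Let $\mathrm{Im}\,\tau>0$, $\eta\in\mathbb C$, $\theta(z)=-\sum_{j\in\mathbb Z}\exp(i\pi(j+\frac12)^2\tau+2\pi i(j+\frac12)(z+\frac12))$. Let $z_1,\dots,z_n\in\mathbb C$ be distinct and $\Lambda_1,\dots,\Lambda_n\in\mathbb Z_{\ge0}$. Let $T_{x_i}^{a}$, $T_\lambda^{a}$ be the shift operators $(T_{x_i}^af)(\lambda,x)=f(\lambda,\dots,x_i+a,\dots)$, $(T_\lambda^af)(\lambda,x)=f(\lambda+a,x)$ on meromorphic functions of $\lambda,x_1,\dots,x_n$. Set $\Delta_\pm(z)=\prod_{i=1}^n\theta(z-z_i\mp\Lambda_i\eta)$, $s=\sum_{i=1}^n(x_i+z_i)$ and \[b(z)=-\sum_{i=1}^n\frac{\theta(\lambda+z+x_i)}{\theta(\lambda)}\prod_{j\ne i}\frac{\theta(z+x_j)}{\theta(x_i-x_j)}\,\Delta_+(-x_i)\,T_{x_i}^{-2\eta}T_\lambda^{2\eta},\] \[c(z)=-\sum_{i=1}^n\frac{\theta(-\lambda+z+x_i-2s)}{\theta(\lambda)}\prod_{j\ne i}\frac{\theta(z+x_j)}{\theta(x_i-x_j)}\,\Delta_-(-x_i)\,T_{x_i}^{2\eta}T_\lambda^{-2\eta}.\]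 These operators map functions vanishing on $S_1$ to functions vanishing on $S_1$ (the shifts preserve $S_1$), so they restrict to meromorphic functions on $S_1$: the restriction is the induced action on the quotient by functions vanishing on $S_1$. *)

(* Defs.v *)
From HB Require Import structures.
From mathcomp Require Import all_boot all_order all_algebra.
From mathcomp Require Import complex.
From mathcomp Require Import all_classical all_reals all_analysis.

Set Implicit Arguments.
Unset Strict Implicit.
Unset Printing Implicit Defensive.

Import Order.TTheory GRing.Theory Num.Theory.
Import numFieldNormedType.Exports.

Local Open Scope classical_set_scope.
Local Open Scope ring_scope.
Local Open Scope complex_scope.

(* The library puts the norm topology on R[i]^o and on R[i] seen as a          *)
(* numClosedFieldType; this makes it available on R[i] itself.                 *)
HB.instance Definition _ (R : realType) := NormedModule.copy R[i] R[i]^o.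

Section Theta.
Context {R : realType}.
Local Notation C := R[i].

Definition cexp (z : C) : C :=
  (expR (complex.Re z))%:C * (cos (complex.Im z) +i* sin (complex.Im z)).

(* [Negz k] is -(k+1), so this is the sum over j >= 0 plus the sum over j < 0. *)
Definition sumZ (u : int -> C) : C :=
  limn (series (fun k : nat => u (Posz k))) +
  limn (series (fun k : nat => u (Negz k))).

Definition theta (tau z : C) : C :=
  - sumZ (fun j : int =>
      cexp ('i * pi%:C * (j%:~R + 2^-1) ^+ 2 * tau +
            2 * 'i * pi%:C * (j%:~R + 2^-1) * (z + 2^-1))).

End Theta.

Section Meromorphic.
Context {R : realType} {V : normedModType R[i]}.
Local Notation C := R[i].
Implicit Types (U : set V) (f g h : V -> C).

Definition holomorphic_on U f := open U /\ forall x, U x -> differentiable f x.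

(* A meromorphic function is represented by a total function which near each   *)
(* point is a quotient g / h of holomorphic functions off the zeros of h,      *)
(* where h vanishes identically on no nonempty open set. The values on the     *)
(* zeros of h are irrelevant: two such functions are the same meromorphic      *)
(* function when they are related by [mero_eq].                                *)
Definition meromorphic f :=
  forall p : V, exists U g h,
    [/\ U p, holomorphic_on U g, holomorphic_on U h,
        U `<=` closure [set x | U x /\ h x != 0] &
        forall x, U x -> h x != 0 -> f x = g x / h x].

Definition mero_eq f g :=
  exists D : set V, [/\ open D, dense D & forall x, D x -> f x = g x].

Lemma mero_eq_refl f : mero_eq f f.
Proof.
by exists setT; split=> //; [exact: openT | move=> O; rewrite setIT].
Qed.

Lemma mero_eq_sym f g : mero_eq f g -> mero_eq g f.
Proof. by move=> [D [oD dD e]]; exists D; split=> // x /e. Qed.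

Lemma mero_eq_trans f g h : mero_eq f g -> mero_eq g h -> mero_eq f h.
Proof.
move=> [D [oD dD e]] [D' [oD' dD' e']]; exists (D `&` D'); split.
- exact: openI.
- exact: denseI.
- by move=> x [/e -> /e' ->].
Qed.

End Meromorphic.

Lemma translate_continuous (K : numFieldType) (V : normedModType K) (v : V) :
  continuous (fun x : V => x + v).
Proof. by move=> x; apply: cvgD; [exact: cvg_id | exact: cvg_cst]. Qed.

Section Operators.
Context {R : realType} {n : nat}.
Local Notation C := R[i].
(* Points of C^(n+1) are pairs (lambda, x). *)
Local Notation Cn1 := (C * 'rV[C]_n)%type.
Variables (tau eta : C) (zs : 'I_n -> C) (Lam : 'I_n -> nat).
Implicit Types (F G : Cn1 -> C) (f g : 'rV[C]_n -> C) (x : 'rV[C]_n).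

Local Notation theta := (theta tau).

Definition shift_x (i : 'I_n) (a : C) F : Cn1 -> C :=
  fun p => F (p.1, p.2 + a *: delta_mx 0 i).

Definition shift_lambda (a : C) F : Cn1 -> C := fun p => F (p.1 + a, p.2).

Definition Delta_plus (z : C) : C :=
  \prod_(i < n) theta (z - zs i - (Lam i)%:R * eta).

Definition Delta_minus (z : C) : C :=
  \prod_(i < n) theta (z - zs i + (Lam i)%:R * eta).

Definition sum_xz x : C := \sum_(i < n) (x 0 i + zs i).

Definition b_op (z : C) F : Cn1 -> C := fun p =>
  let lambda := p.1 in let x := p.2 in
  - \sum_(i < n)
      (theta (lambda + z + x 0 i) / theta lambda *
       (\prod_(j < n | j != i) (theta (z + x 0 j) / theta (x 0 i - x 0 j))) *
       Delta_plus (- x 0 i) *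
       shift_x i (- (2 * eta)) (shift_lambda (2 * eta) F) p).

Definition c_op (z : C) F : Cn1 -> C := fun p =>
  let lambda := p.1 in let x := p.2 in
  - \sum_(i < n)
      (theta (- lambda + z + x 0 i - 2 * sum_xz x) / theta lambda *
       (\prod_(j < n | j != i) (theta (z + x 0 j) / theta (x 0 i - x 0 j))) *
       Delta_minus (- x 0 i) *
       shift_x i (2 * eta) (shift_lambda (- (2 * eta)) F) p).

Definition T_op (vartheta z : C) F : Cn1 -> C :=
  fun p => b_op z F p + vartheta * c_op z F p.

Definition S1 : set Cn1 :=
  [set p : Cn1 | p.1 + \sum_(i < n) p.2 0 i + \sum_(i < n) zs i = 0].

(* S1 is the graph of an affine function of x. Functions on S1 are written in  *)
(* the global coordinates x.                                                   *)
Definition S1_pt x : Cn1 := (- sum_xz x, x).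

Lemma range_S1_pt : range S1_pt = S1.
Proof.
apply/seteqP; split=> [_ [x _ <-]|[l x]] /=; rewrite /S1 /S1_pt /sum_xz /=.
  by rewrite big_split /= -addrA addNr.
move=> e; exists x => //; congr pair.
by apply/eqP; rewrite eq_sym -addr_eq0 big_split /= addrA; apply/eqP.
Qed.

Definition restrict_S1 F : 'rV[C]_n -> C := fun x => F (S1_pt x).

Definition extend_S1 f : Cn1 -> C := fun p => f p.2.

Lemma extend_S1K f : restrict_S1 (extend_S1 f) = f.
Proof. by []. Qed.

(* The operator induced on functions on S1; by [restrict_T_op] the choice of   *)
(* the extension is immaterial.                                                *)
Definition T_S1 (vartheta z : C) f : 'rV[C]_n -> C :=
  restrict_S1 (T_op vartheta z (extend_S1 f)).

Lemma S1_pt_shift x i a :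
  S1_pt (x + a *: delta_mx 0 i) =
  ((S1_pt x).1 - a, (S1_pt x).2 + a *: delta_mx 0 i).
Proof.
rewrite /S1_pt /sum_xz /=; congr pair; rewrite -opprD; congr (- _).
rewrite (bigD1 i) //= [in RHS](bigD1 i) //= !mxE !eqxx mulr1.
rewrite [X in _ + X](_ : _ = \sum_(j < n | j != i) (x 0 j + zs j)); last first.
  apply: eq_bigr => j ji; rewrite !mxE eqxx /= (negbTE ji) mulr0.
  by rewrite addr0.
by rewrite -!addrA; congr (_ + _); rewrite addrC -!addrA.
Qed.

Lemma T_op_S1_pt vartheta z F x :
  T_op vartheta z F (S1_pt x) = T_S1 vartheta z (restrict_S1 F) x.
Proof.
have eqs (i : 'I_n) (a : C) :
    shift_x i a (shift_lambda (- a) F) (S1_pt x) =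
    shift_x i a (shift_lambda (- a) (extend_S1 (restrict_S1 F))) (S1_pt x).
  by rewrite /shift_x /shift_lambda /extend_S1 /restrict_S1 S1_pt_shift.
rewrite /T_S1 /T_op /b_op /c_op {1}/restrict_S1.
congr (- _ + _ * - _); apply: eq_bigr => i _; last by rewrite eqs.
by move: (eqs i (- (2 * eta))); rewrite opprK => ->.
Qed.

Lemma restrict_T_op vartheta z F :
  restrict_S1 (T_op vartheta z F) = T_S1 vartheta z (restrict_S1 F).
Proof. by apply/funext => x; rewrite -T_op_S1_pt. Qed.

Lemma T_op_S1_vanish vartheta z F :
  (forall p, S1 p -> F p = 0) -> forall p, S1 p -> T_op vartheta z F p = 0.
Proof.
move=> F0 p; rewrite -range_S1_pt => -[x _ <-]; rewrite T_op_S1_pt.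
have -> : restrict_S1 F = fun=> 0.
  by apply/funext => y; apply: F0; rewrite -range_S1_pt; exists y.
by rewrite /T_S1 /restrict_S1 /T_op /b_op /c_op !big1 ?oppr0 ?mulr0 ?addr0 //
  => i _; rewrite mulr0.
Qed.

Lemma T_S1_mero_eq vartheta z f g :
  mero_eq f g -> mero_eq (T_S1 vartheta z f) (T_S1 vartheta z g).
Proof.
move=> [D [oD dD e]].
pose sh (i : 'I_n) (a : C) (x : 'rV[C]_n) := x + a *: delta_mx 0 i.
have shK i a : cancel (sh i a) (sh i (- a)).
  by move=> x; rewrite /sh scaleNr addrK.
have sh_cont i a : continuous (sh i a).
  exact: translate_continuous.
have oS i a : open (sh i a @^-1` D).
  by apply: open_comp => // x _; exact: sh_cont.
have dS i a : dense (sh i a @^-1` D).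
  move=> O [y Oy] oO.
  have [||u [Ou Du]] := dD (sh i (- a) @^-1` O).
  - by exists (sh i a y); rewrite /= shK.
  - by apply: open_comp => // x _; exact: sh_cont.
  - exists (sh i (- a) u); split => //=.
    by move: (shK i (- a) u); rewrite opprK => ->.
pose E (r : seq 'I_n) := \big[setI/setT]_(i <- r)
  ((sh i (- (2 * eta)) @^-1` D) `&` (sh i (2 * eta) @^-1` D)).
have [oE dE] : open (E (index_enum 'I_n)) /\ dense (E (index_enum 'I_n)).
  rewrite /E; elim: (index_enum 'I_n) => [|i r [oEr dEr]].
    by rewrite big_nil; split; [exact: openT | move=> O; rewrite setIT].
  rewrite big_cons; split; first by do 2?apply: openI.
  by apply: denseI => //; [exact: openI | exact: denseI].
have sub (r : seq 'I_n) i : i \in r -> E r `<=`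
    (sh i (- (2 * eta)) @^-1` D) `&` (sh i (2 * eta) @^-1` D).
  rewrite /E; elim: r => //= j r IHr; rewrite inE big_cons.
  by move=> /orP[/eqP -> x []//|ir x [_]]; exact: IHr.
exists (E (index_enum 'I_n)); split => // x Ex.
rewrite /T_S1 /restrict_S1 /T_op /b_op /c_op /shift_x /shift_lambda /extend_S1.
congr (- _ + _ * - _); apply: eq_bigr => i _; congr (_ * _) => /=; apply: e;
  by have [] := sub _ i (mem_index_enum i) x Ex.
Qed.

End Operators.

(* Main.v *)
Require Import Defs.
From HB Require Import structures.
From mathcomp Require Import all_boot all_order all_algebra.
From mathcomp Require Import complex.
From mathcomp Require Import all_classical all_reals all_analysis.
From mathcomp Require Import ring lra zify.

Set Implicit Arguments.
Unset Strict Implicit.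
Unset Printing Implicit Defensive.

Import Order.TTheory GRing.Theory Num.Theory.
Import numFieldNormedType.Exports.
Import ComplexField.Normc.

Local Open Scope classical_set_scope.
Local Open Scope ring_scope.
Local Open Scope complex_scope.

(** On S1 one has lambda = - s, so that the arguments lambda + z + x_i and
    - lambda + z + x_i - 2 s agree and the two families of operators carry the
    same coefficient K_i(z; x). Hence T(z) = sum_i K_i(z; x) D_i, where the
    difference operator D_i involves the variable x_i only and z occurs only in
    K_i ([T_S1E]). As a function of z, K_i lies in the space of theta functions
    of degree n with fixed sum of zeros, and it vanishes at - x_j for j != i:
    T(z) interpolates the commuting operators D_i, and this is why the T(z)
    commute.

    Concretely, one compares in T(z) T(w) f and T(w) T(z) f the terms in which f
    is shifted by a in x_i and by b in x_j. If i = j they agree because a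
    translation of x_i changes K_i(z; x) only by a factor free of z
    ([kernel_same]). If i != j, the two orders of the shifts must be added
    ([kernel_exchange]). By the three-term relation of theta, exchanging z and w
    changes the coefficient of the first order by a quantity that depends neither
    on a nor on b, and that of the second order by the opposite quantity
    ([theta_exchange], [exchange_algebra]).

    The three-term relation is obtained without complex integration. Regrouping
    the double series theta(x + y) theta(x - y) according to parity gives
    E(x) O(y) - O(x) E(y) for two functions E and O ([theta_mul]); so these
    products are the 2 x 2 minors of a two-row matrix, and the relation among
    them is the Pluecker relation ([theta_pluecker]). The antisymmetry of the
    same formula shows that theta is odd ([theta_opp]).

    All this holds where no denominator vanishes, which is an open dense set:
    theta is continuous ([theta_continuous]) and does not vanish identically on
    any horizontal segment ([theta_neq0_near]). Indeed on a horizontal line theta is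
    a trigonometric series with such small coefficients that it is the sum of a
    power series converging everywhere. If it vanished on a segment it would
    vanish on the whole line ([trig_series_zero]), and averaging over roots of
    unity would make one of its coefficients vanish ([trig_series_coeff0]),
    whereas all of them are exponentials. *)

(** * Unconditional sums of complex families *)

Section Sums.
Context {R : realType}.
Local Notation C := R[i].
Implicit Types (I J : eqType).

(** Unconditional convergence. Repetition-free lists stand for finite sets of
    indices, so that sums can be reindexed and regrouped without an order on
    the index type. *)
Definition has_sum I (u : I -> C) (l : C) := forall e : R, 0 < e ->
  exists A : seq I, forall B, uniq B -> {subset A <= B} ->
    normc (\sum_(i <- B) u i - l) < e.

Definition abs_summable I (u : I -> C) := exists M : R, forall B, uniq B ->
  \sum_(i <- B) normc (u i) <= M.

Lemma normc_ge0 (x : C) : 0 <= normc x.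
Proof. by case: x => a b /=; exact: sqrtr_ge0. Qed.

Lemma normc_triangle (x y : C) : normc (x + y) <= normc x + normc y.
Proof. exact: le_normcD. Qed.

Lemma normc_opp (x : C) : normc (- x) = normc x.
Proof. exact: normcN. Qed.

Lemma normc_sub (x y : C) : normc (x - y) = normc (y - x).
Proof. by rewrite -normc_opp opprB. Qed.

Lemma normcR (x : R) : normc x%:C = `|x|.
Proof. by rewrite /normc /= expr0n addr0 sqrtr_sqr. Qed.

Lemma normc_sum I (r : seq I) (u : I -> C) :
  normc (\sum_(i <- r) u i) <= \sum_(i <- r) normc (u i).
Proof.
elim/big_rec2: _ => [|i y x _ h]; first by rewrite normc0.
by apply: le_trans (normc_triangle _ _) _; rewrite lerD2l.
Qed.

Lemma has_sum_unique I (u : I -> C) l l' :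
  has_sum u l -> has_sum u l' -> l = l'.
Proof.
move=> h h'; apply/eqP; rewrite -subr_eq0; apply/eqP/eq0_normc/eqP.
rewrite eq_le normc_ge0 andbT; apply/ler_addgt0Pl => e e0.
have e2 : 0 < e / 2 by lra.
have [A hA] := h _ e2; have [A' hA'] := h' _ e2.
pose B := undup (A ++ A').
have uB : uniq B by exact: undup_uniq.
have sA : {subset A <= B} by move=> x xA; rewrite mem_undup mem_cat xA.
have sA' : {subset A' <= B} by move=> x xA; rewrite mem_undup mem_cat xA orbT.
have {}hA := hA B uB sA; have {}hA' := hA' B uB sA'.
have -> : l - l' = (l - \sum_(i <- B) u i) + (\sum_(i <- B) u i - l') by ring.
apply: le_trans (normc_triangle _ _) _.
by rewrite (normc_sub l); lra.
Qed.

Lemma eq_has_sum I (u v : I -> C) l : u =1 v -> has_sum u l -> has_sum v l.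
Proof. by move=> /funext ->. Qed.

Lemma sub_cat_l (T : eqType) (r s t : seq T) :
  {subset r ++ s <= t} -> {subset r <= t}.
Proof. by move=> h x xr; apply: h; rewrite mem_cat xr. Qed.

Lemma sub_cat_r (T : eqType) (r s t : seq T) :
  {subset r ++ s <= t} -> {subset s <= t}.
Proof. by move=> h x xr; apply: h; rewrite mem_cat xr orbT. Qed.

Lemma has_sumD I (u v : I -> C) a b : has_sum u a -> has_sum v b ->
  has_sum (fun i => u i + v i) (a + b).
Proof.
move=> hu hv e e0; have e2 : 0 < e / 2 by lra.
have [A hA] := hu _ e2; have [A' hA'] := hv _ e2.
exists (A ++ A') => B uB sB.
have {}hA := hA B uB (sub_cat_l sB).
have {}hA' := hA' B uB (sub_cat_r sB).
rewrite big_split /= opprD addrACA; apply: le_lt_trans (normc_triangle _ _) _; lra.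
Qed.

Lemma has_sumZ I (u : I -> C) (c a : C) : has_sum u a ->
  has_sum (fun i => c * u i) (c * a).
Proof.
move=> hu e e0; have c0 := normc_ge0 c.
have e2 : 0 < e / (normc c + 1) by apply: divr_gt0 => //; lra.
have [A hA] := hu _ e2; exists A => B uB sB.
rewrite -mulr_sumr -mulrBr normcM.
have := hA B uB sB; rewrite ltr_pdivlMr; last by lra.
have := normc_ge0 (\sum_(i <- B) u i - a); nra.
Qed.

Lemma has_sum0 I : has_sum (fun _ : I => 0 : C) 0.
Proof. by move=> e e0; exists [::] => B _ _; rewrite big1// subrr normc0. Qed.

Lemma has_sum_sum I J (r : seq J) (u : J -> I -> C) (a : J -> C) :
  (forall j, has_sum (u j) (a j)) ->
  has_sum (fun i => \sum_(j <- r) u j i) (\sum_(j <- r) a j).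
Proof.
move=> h; elim: r => [|j r ih].
  by rewrite big_nil; apply: eq_has_sum (@has_sum0 _) => i; rewrite big_nil.
rewrite big_cons; apply: eq_has_sum (has_sumD (h j) ih) => i.
by rewrite big_cons.
Qed.

Lemma has_sum_single I (i0 : I) (c : C) :
  has_sum (fun i => if i == i0 then c else 0) c.
Proof.
move=> e e0; exists [:: i0] => B uB sB.
rewrite (bigD1_seq i0) ?sB ?mem_head//= eqxx big1 ?addr0 ?subrr ?normc0//.
by move=> i /negbTE ->.
Qed.

Lemma big_subset_le I (B B' : seq I) (v : I -> R) : uniq B -> uniq B' ->
  {subset B <= B'} -> (forall i, 0 <= v i) ->
  \sum_(i <- B) v i <= \sum_(i <- B') v i.
Proof.
move=> uB uB' sB v0; rewrite [leRHS](bigID (fun i => i \in B)) /= -[leLHS]addr0.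
apply: lerD; last by apply: sumr_ge0.
have p : perm_eq B [seq i <- B' | i \in B].
  apply: uniq_perm => //; first exact: filter_uniq.
  by move=> x; rewrite mem_filter; case: (boolP (x \in B)) => // /sB ->.
by rewrite (perm_big _ p) big_filter.
Qed.

Lemma has_sum_le I (u : I -> C) l (M : R) : has_sum u l ->
  (forall B, uniq B -> \sum_(i <- B) normc (u i) <= M) -> normc l <= M.
Proof.
move=> h hM; apply/ler_addgt0Pl => e e0; have [A hA] := h _ e0.
have uA := undup_uniq A.
have /hA - /(_ uA) hl : {subset A <= undup A} by move=> x; rewrite mem_undup.
set S := \sum_(i <- _) _ in hl.
have -> : l = (l - S) + S by ring.
apply: le_trans (normc_triangle _ _) _; rewrite normc_sub.
apply: lerD; first exact: ltW.
exact: le_trans (normc_sum _ _) (hM _ uA).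
Qed.

(** Finite sums within [e] of the supremum of all finite sums leave at most
    [e] for every disjoint finite sum. *)
Lemma abs_summable_tail I (u : I -> C) (e : R) : abs_summable u -> 0 < e ->
  exists A : seq I, forall B, uniq B -> (forall i, i \in B -> i \notin A) ->
    \sum_(i <- B) normc (u i) <= e.
Proof.
move=> [M hM] e0.
pose E := [set x : R | exists2 B : seq I, uniq B & x = \sum_(i <- B) normc (u i)].
have supE : has_sup E.
  split; first by exists 0; exists [::] => //; rewrite big_nil.
  by exists M => _ [B uB ->]; exact: hM.
have [_ [A uA ->] hA] := sup_adherent e0 supE.
exists A => B uB dB.
have /(ub_le_sup supE.2) : E (\sum_(i <- A ++ B) normc (u i)).
  exists (A ++ B) => //; rewrite cat_uniq uA uB andbT /=.
  by apply/hasPn => i /dB.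
rewrite big_cat /=; lra.
Qed.

Lemma has_sum_ge0 I (v : I -> R) (M : R) : (forall i, 0 <= v i) ->
  (forall B, uniq B -> \sum_(i <- B) v i <= M) ->
  exists l, has_sum (fun i => (v i)%:C) l.
Proof.
move=> v0 hM.
pose E := [set x : R | exists2 B : seq I, uniq B & x = \sum_(i <- B) v i].
have supE : has_sup E.
  split; first by exists 0; exists [::] => //; rewrite big_nil.
  by exists M => _ [B uB ->]; exact: hM.
exists (sup E)%:C => e e0.
have [_ [A uA ->] hA] := sup_adherent e0 supE.
exists A => B uB sB; 
have -> : \sum_(i <- B) (v i)%:C - (sup E)%:C = (\sum_(i <- B) v i - sup E)%:C.
  by rewrite rmorphB rmorph_sum.
rewrite normcR.
have : \sum_(i <- B) v i <= sup E by apply: (ub_le_sup supE.2); exists B.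
have := big_subset_le uA uB sB v0 => ? ?.
by rewrite ler0_norm; lra.
Qed.

Lemma normc_geRe (x : C) : `|complex.Re x| <= normc x.
Proof.
by case: x => a b /=; rewrite -sqrtr_sqr ler_wsqrtr// lerDl sqr_ge0.
Qed.

Lemma normc_geIm (x : C) : `|complex.Im x| <= normc x.
Proof.
by case: x => a b /=; rewrite -sqrtr_sqr ler_wsqrtr// lerDr sqr_ge0.
Qed.

(** The real and the imaginary part are each a difference of two nonnegative
    families with bounded finite sums, [normc u + v] and [normc u]; those are
    summed by the supremum of their finite sums. *)
Lemma abs_has_sum I (u : I -> C) : abs_summable u -> exists l, has_sum u l.
Proof.
move=> [M hM].
have dom (v : I -> R) : (forall i, `|v i| <= normc (u i)) ->
    exists l, has_sum (fun i => (v i)%:C) l.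
  move=> hv.
  have [|B uB|a ha] := @has_sum_ge0 I (fun i => normc (u i)) M.
  - by move=> i; exact: normc_ge0.
  - exact: hM.
  have [|B uB|b hb] := @has_sum_ge0 I (fun i => normc (u i) + v i) (M + M).
  - by move=> i; have := hv i; rewrite ler_norml; lra.
  - rewrite big_split; apply: lerD; first exact: hM.
    by apply: le_trans (hM _ uB); apply: ler_sum => i _; apply: ler_normlW.
  exists (b + -1 * a); apply: eq_has_sum (has_sumD hb (has_sumZ (-1) ha)) => i.
  by rewrite rmorphD /=; ring.
have [a ha] := dom (fun i => complex.Re (u i)) (fun i => normc_geRe (u i)).
have [b hb] := dom (fun i => complex.Im (u i)) (fun i => normc_geIm (u i)).
exists (a + 'i * b); apply: eq_has_sum (has_sumD ha (has_sumZ 'i hb)) => i.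
by rewrite -complexE.
Qed.

Lemma abs_summable_le I (u v : I -> C) :
  (forall i, normc (u i) <= normc (v i)) -> abs_summable v -> abs_summable u.
Proof.
by move=> h [M hM]; exists M => B uB; apply: le_trans (hM _ uB); apply: ler_sum.
Qed.

Lemma abs_summableZ I (u : I -> C) c :
  abs_summable u -> abs_summable (fun i => c * u i).
Proof.
move=> [M hM]; exists (normc c * M) => B uB.
under eq_bigr do rewrite normcM.
by rewrite -mulr_sumr ler_wpM2l ?normc_ge0 ?hM.
Qed.

Lemma abs_summable_comp I J (h : J -> I) (u : I -> C) : injective h ->
  abs_summable u -> abs_summable (u \o h).
Proof.
move=> hi [M hM]; exists M => B uB.
by have := hM (map h B); rewrite big_map map_inj_uniq// => /(_ uB).
Qed.

Lemma has_sum_reindex I J (h : J -> I) (u : I -> C) l : bijective h ->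
  has_sum (u \o h) l -> has_sum u l.
Proof.
move=> [g gK hK] H e e0; have [A hA] := H _ e0.
exists (map h A) => B uB sB.
have {hA} := hA (map g B); rewrite big_map map_inj_uniq; last exact: can_inj hK.
under eq_bigr do rewrite /= hK.
apply=> // x xA; apply/mapP; exists (h x); rewrite ?gK// sB//.
exact: map_f.
Qed.

Lemma big_sum_type I J (B : seq (I + J)) (V : nmodType) (u : I + J -> V) :
  \sum_(i <- B) u i =
  \sum_(i <- pmap (fun s => if s is inl i then Some i else None) B) u (inl i) +
  \sum_(j <- pmap (fun s => if s is inr j then Some j else None) B) u (inr j).
Proof.
elim: B => [|[i|j] B ih]; rewrite ?big_nil ?addr0// big_cons ih /= big_cons.
  by rewrite addrA.
by rewrite addrCA.
Qed.

Lemma has_sum_sumtype I J (u : I + J -> C) a b :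
  has_sum (u \o inl) a -> has_sum (u \o inr) b -> has_sum u (a + b).
Proof.
move=> hu hv e e0; have e2 : 0 < e / 2 by lra.
have [A hA] := hu _ e2; have [A' hA'] := hv _ e2.
exists (map inl A ++ map inr A') => B uB sB; rewrite big_sum_type.
set BI := pmap _ B; set BJ := pmap _ B.
have {}hA : normc (\sum_(i <- BI) u (inl i) - a) < e / 2.
  apply: hA.
    by rewrite /BI; apply: (@pmap_uniq _ _ _ inl) => // -[i|j].
  move=> i iA; rewrite mem_pmap; apply/mapP; exists (inl i) => //.
  by apply: sB; rewrite mem_cat map_f.
have {}hA' : normc (\sum_(i <- BJ) u (inr i) - b) < e / 2.
  apply: hA'.
    by rewrite /BJ; apply: (@pmap_uniq _ _ _ inr) => // -[i|j].
  move=> i iA; rewrite mem_pmap; apply/mapP; exists (inr i) => //.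
  by apply: sB; rewrite mem_cat orbC map_f.
rewrite opprD addrACA; apply: le_lt_trans (normc_triangle _ _) _; lra.
Qed.

Lemma abs_summable_sumtype I J (u : I + J -> C) :
  abs_summable (u \o inl) -> abs_summable (u \o inr) -> abs_summable u.
Proof.
move=> [M hM] [M' hM']; exists (M + M') => B uB; rewrite big_sum_type.
apply: lerD; first apply: hM; last apply: hM'.
  by apply: (@pmap_uniq _ _ _ inl) => // -[i|j].
by apply: (@pmap_uniq _ _ _ inr) => // -[i|j].
Qed.

(** For finitely many rows, one finite set [K] of columns nearly exhausts all of
    them at once; the rectangle spanned by these rows and [K] can be taken large
    enough for its sum to be near the total. *)
Lemma has_sum_rows I J (F : I * J -> C) (r : I -> C) g :
  (forall i, has_sum (fun j => F (i, j)) (r i)) -> has_sum F g -> has_sum r g.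
Proof.
move=> hr hF e e0; have e2 : 0 < e / 2 by lra.
have [A hA] := hF _ e2; exists (map fst A) => B uB sB.
have approx (d : R) : 0 < d -> exists K0 : seq J, forall K, uniq K ->
    {subset K0 <= K} -> normc (\sum_(i <- B) (r i - \sum_(j <- K) F (i, j))) < d.
  elim: B {uB sB} d => [|i B ih] d d0.
    by exists [::] => K _ _; rewrite big_nil normc0.
  have d2 : 0 < d / 2 by lra.
  have [K1 h1] := ih _ d2; have [K2 h2] := hr i _ d2.
  exists (K1 ++ K2) => K uK sK; rewrite big_cons.
  have {}h1 := h1 K uK (sub_cat_l sK).
  have {}h2 := h2 K uK (sub_cat_r sK).
  by apply: le_lt_trans (normc_triangle _ _) _; rewrite normc_sub; lra.
have [K0 hK] := approx _ e2; pose K := undup (K0 ++ map snd A).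
have uK : uniq K by exact: undup_uniq.
have sK0 : {subset K0 <= K} by move=> x xK; rewrite mem_undup mem_cat xK.
have {}hK := hK K uK sK0.
have {}hA : normc (\sum_(p <- [seq (i, j) | i <- B, j <- K]) F p - g) < e / 2.
  apply: hA; first by apply: allpairs_uniq => // -[? ?] [? ?] _ _ /= [-> ->].
  move=> [i j] ijA; apply/allpairsP; exists (i, j); split=> //=.
    by apply: sB; apply/mapP; exists (i, j).
  by rewrite mem_undup mem_cat; apply/orP; right; apply/mapP; exists (i, j).
have -> : \sum_(i <- B) r i - g = \sum_(i <- B) (r i - \sum_(j <- K) F (i, j)) +
    (\sum_(p <- [seq (i, j) | i <- B, j <- K]) F p - g).
  by rewrite big_allpairs_dep /= sumrB; ring.
by apply: le_lt_trans (normc_triangle _ _) _; lra.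
Qed.

(** Absolute summability provides a total; by uniqueness the row sums
    determine it. *)
Lemma has_sum_pair I J (F : I * J -> C) (r : I -> C) g :
  (forall i, has_sum (fun j => F (i, j)) (r i)) -> has_sum r g ->
  abs_summable F -> has_sum F g.
Proof.
move=> hr hg /abs_has_sum[l hF].
by rewrite (has_sum_unique hg (has_sum_rows hr hF)).
Qed.

Lemma abs_summable_pair I J (F : I * J -> C) (m : I -> R) (M : R) :
  (forall i B, uniq B -> \sum_(j <- B) normc (F (i, j)) <= m i) ->
  (forall B, uniq B -> \sum_(i <- B) m i <= M) -> abs_summable F.
Proof.
move=> hm hM; exists M => B uB.
pose B1 := undup (map fst B); pose B2 := undup (map snd B).
apply: (@le_trans _ _ (\sum_(p <- [seq (i, j) | i <- B1, j <- B2]) normc (F p))).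
  apply: big_subset_le => //.
  - apply: allpairs_uniq; rewrite ?undup_uniq//.
    by move=> [? ?] [? ?] _ _ /= [-> ->].
  - move=> [i j] ijB; apply/allpairsP; exists (i, j).
    by split=> //=; rewrite mem_undup; apply/mapP; exists (i, j).
  - by move=> p; exact: normc_ge0.
rewrite big_allpairs_dep /=; apply: le_trans (hM B1 (undup_uniq _)).
by apply: ler_sum => i _; apply: hm; exact: undup_uniq.
Qed.

Lemma has_sum_prod I J (u : I -> C) (v : J -> C) a b :
  abs_summable u -> abs_summable v -> has_sum u a -> has_sum v b ->
  has_sum (fun p => u p.1 * v p.2) (a * b).
Proof.
move=> [M hM] [N hN] hu hv.
apply: (@has_sum_pair _ _ _ (fun i => b * u i)).
- by move=> i /=; rewrite mulrC; exact: has_sumZ.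
- by rewrite mulrC; exact: has_sumZ.
apply: (@abs_summable_pair _ _ _ (fun i => N * normc (u i)) (N * M)) => [i|] B uB.
  under eq_bigr do rewrite normcM /=.
  by rewrite -mulr_sumr mulrC ler_wpM2r ?normc_ge0 ?hN.
by rewrite -mulr_sumr ler_wpM2l ?hM//; have := hN [::]; rewrite big_nil; apply.
Qed.

End Sums.

(** * Sums over the integers and Gaussian series *)

Section Series.
Context {R : realType}.
Local Notation C := R[i].

Lemma abs_summable_reindex (I J : eqType) (h : J -> I) (u : I -> C) :
  bijective h -> abs_summable (u \o h) -> abs_summable u.
Proof.
move=> [g gK hK] /(abs_summable_comp (can_inj hK)).
by have -> : (u \o h) \o g = u by apply/funext => i /=; rewrite hK.
Qed.

Lemma abs_summableD (I : eqType) (u v : I -> C) :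
  abs_summable u -> abs_summable v -> abs_summable (fun i => u i + v i).
Proof.
move=> [M hM] [N hN]; exists (M + N) => B uB.
apply: le_trans (lerD (hM B uB) (hN B uB)); rewrite -big_split /=.
by apply: ler_sum => i _; exact: normc_triangle.
Qed.

Lemma normE (x : C) : `|x| = (normc x)%:C.
Proof. by case: x => a b; rewrite normc_def. Qed.

Lemma has_sum_cvg (u : nat -> C) l : has_sum u l -> series u @ \oo --> l.
Proof.
move=> h; apply/cvgrPdist_lt => e; rewrite ltcE => /andP[/eqP ie re].
have [A hA] := h _ re; exists (\max_(i <- A) i).+1 => // n /= nA.
rewrite distrC normE ltcE /= ie eqxx /=.
apply: hA; first exact: iota_uniq.
move=> i iA; rewrite mem_index_iota /=; apply: leq_trans nA.
by rewrite ltnS; apply: leq_bigmax_seq.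
Qed.

Lemma bij_int : bijective
  (fun s : nat + nat => match s with inl n => Posz n | inr n => Negz n end).
Proof. by exists (fun k => match k with Posz n => inl n | Negz n => inr n end); case. Qed.

(** The two constructors of [int] split an unconditional sum into the two
    one-sided series. *)
Lemma sumZ_has_sum (u : int -> C) : abs_summable u -> has_sum u (sumZ u).
Proof.
move=> su.
have [|a ha] := @abs_has_sum _ _ (u \o Posz).
  by apply: abs_summable_comp su => i j [].
have [|b hb] := @abs_has_sum _ _ (u \o Negz).
  by apply: abs_summable_comp su => i j [].
have -> : sumZ u = a + b.
  rewrite /sumZ; congr (_ + _); apply: (cvg_lim (@norm_hausdorff _ _));
    exact: has_sum_cvg.
by apply: (has_sum_reindex bij_int); apply: has_sum_sumtype.
Qed.

Lemma abs_summable_geometric (q : R) : 0 <= q < 1 ->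
  abs_summable (fun n : nat => (q ^+ n)%:C).
Proof.
move=> /andP[q0 q1]; exists (1 - q)^-1 => B uB.
under eq_bigr do rewrite normcR ger0_norm ?exprn_ge0//.
have sB : {subset B <= index_iota 0 (\max_(i <- B) i).+1}.
  by move=> i iB; rewrite mem_index_iota ltnS leq_bigmax_seq.
have uI : uniq (index_iota 0 (\max_(i <- B) i).+1) by exact: iota_uniq.
apply: le_trans (big_subset_le uB uI sB _) _ => [i|].
  exact: exprn_ge0.
rewrite big_mkord; set N := _.+1.
have := subrX1 q N; have : 0 <= q ^+ N by exact: exprn_ge0.
set S := \sum_(i < N) _ => qN e.
rewrite -[leRHS]mul1r ler_pdivlMr; last by lra.
lra.
Qed.

Lemma normc_cexp (z : C) : normc (cexp z) = expR (complex.Re z).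
Proof.
rewrite /cexp normcM normcR ger0_norm ?expR_ge0//=.
by rewrite cos2Dsin2 sqrtr1 mulr1.
Qed.

Lemma cexpD (a b : C) : cexp (a + b) = cexp a * cexp b.
Proof.
case: a => a a'; case: b => b b'; rewrite /cexp /= expRD cosD sinD.
by apply/eqP; rewrite eq_complex /=; apply/andP; split; apply/eqP; ring.
Qed.

Lemma cexp0 : cexp (0 : C) = 1.
Proof. by rewrite /cexp /= expR0 cos0 sin0 mul1r. Qed.

Lemma cexp_neq0 (z : C) : cexp z != 0.
Proof.
apply/eqP => e; have := normc_cexp z.
by rewrite e normc0 => /esym/eqP; rewrite expR_eq0.
Qed.

Lemma cexpN (z : C) : cexp (- z) = (cexp z)^-1.
Proof.
apply: (mulIf (cexp_neq0 z)).
by rewrite -cexpD addNr cexp0 mulVf// cexp_neq0.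
Qed.

Lemma cexpMn (z : C) n : cexp (n%:R * z) = cexp z ^+ n.
Proof.
elim: n => [|n ih]; first by rewrite mul0r cexp0.
by rewrite -natr1 mulrDl mul1r cexpD ih exprSr.
Qed.

Lemma cexpMz (z : C) (k : int) : cexp (k%:~R * z) = cexp z ^ k.
Proof.
case: k => n; first exact: cexpMn.
by rewrite NegzE mulrNz mulNr cexpN cexpMn.
Qed.

Lemma cexp_real (x : R) : cexp x%:C = (expR x)%:C.
Proof. by rewrite /cexp /= cos0 sin0 mulr1. Qed.

(** Every series used for theta has terms of this shape, so that one estimate,
    [gauss_summable], sums them all. *)
Definition gauss (a b c : C) (j : int) : C :=
  cexp (a * j%:~R ^+ 2 + b * j%:~R + c).

Lemma Re_mulint (a : C) (j : int) : complex.Re (a * j%:~R) = complex.Re a * j%:~R.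
Proof.
have -> : (j%:~R : C) = (j%:~R : R)%:C by rewrite rmorph_int.
by case: a => x y /=; rewrite mulr0 subr0.
Qed.

Lemma ReD (a b : C) : complex.Re (a + b) = complex.Re a + complex.Re b.
Proof. by case: a b => ? ? []. Qed.

(** Completing the square bounds the real part of the exponent by [K - |j|], so
    that a geometric series in [|j|] dominates. *)
Lemma gauss_summable (a b c : C) : complex.Re a < 0 -> abs_summable (gauss a b c).
Proof.
move=> a0; set al := - complex.Re a; have al0 : 0 < al by rewrite /al; lra.
set be := `|complex.Re b| + 1.
set K := complex.Re c + be ^+ 2 / (4 * al).
pose q := expR (-1 : R).
have q01 : 0 <= q < 1 by rewrite expR_ge0 expR_lt1; lra.
apply: (@abs_summable_le _ _ _ (fun j => (expR K)%:C * (q ^+ `|j|%N)%:C)) => [j|].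
  rewrite /gauss normc_cexp !ReD Re_mulint expr2 mulrA !Re_mulint normcM !normcR.
  rewrite (ger0_norm (expR_ge0 _)) ger0_norm ?exprn_ge0 ?expR_ge0//.
  rewrite /q -expRM_natl -expRD ler_expR.
  have -> : (`|j|%N)%:R = `|j%:~R| :> R by rewrite natr_absz intr_norm.
  set t : R := j%:~R.
  have h1 : complex.Re b * t <= `|complex.Re b| * `|t|.
    by rewrite -normrM; exact: ler_norm.
  have h2 : 0 <= al * (`|t| - be / (2 * al)) ^+ 2.
    by rewrite mulr_ge0 ?sqr_ge0// ltW.
  have h3 : al * (`|t| - be / (2 * al)) ^+ 2 =
      al * t ^+ 2 - be * `|t| + be ^+ 2 / (4 * al).
    by rewrite -(real_normK (num_real t)); field; rewrite gt_eqF.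
  have h4 : complex.Re a * t * t = - (al * t ^+ 2) by rewrite /al; ring.
  by rewrite /K h4 /be in h2 h3 *; lra.
apply: abs_summableZ; apply: (abs_summable_reindex bij_int).
apply: abs_summable_sumtype => /=.
  exact: abs_summable_geometric.
apply: abs_summable_le (abs_summable_geometric q01) => n.
rewrite -[leLHS]/(normc (q ^+ n.+1)%:C).
have /andP[q0 q1] := q01.
rewrite !normcR !ger0_norm ?exprn_ge0// exprS.
by rewrite ler_piMl ?exprn_ge0// ltW.
Qed.

End Series.

(** * The addition formula of theta *)

Section ThetaAddition.
Context {R : realType}.
Local Notation C := R[i].
Variable tau : C.
Hypothesis tau_gt0 : 0 < complex.Im tau.

Let ipi : C := 'i * pi%:C.

Definition theta_term (z : C) (j : int) : C :=
  cexp ('i * pi%:C * (j%:~R + 2^-1) ^+ 2 * tau +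
        2 * 'i * pi%:C * (j%:~R + 2^-1) * (z + 2^-1)).

Lemma theta_termE z : theta_term z = gauss (ipi * tau)
  (ipi * tau + 2 * ipi * (z + 2^-1)) (ipi * tau / 4 + ipi * (z + 2^-1)).
Proof.
by apply/funext => j; rewrite /theta_term /gauss -/ipi; congr cexp; rewrite /ipi; field.
Qed.

Lemma Re_ipitau (c : R) : 0 < c -> complex.Re (c%:C * (ipi * tau)) < 0.
Proof.
move=> c0; rewrite /ipi; case: tau tau_gt0 => t1 t2 /= t20.
have := pi_gt0 R => p0.
have := mulr_gt0 c0 (mulr_gt0 p0 t20).
by simpc; lra.
Qed.

Lemma theta_term_summable z : abs_summable (theta_term z).
Proof.
rewrite theta_termE; apply: gauss_summable.
by have := Re_ipitau ltr01; rewrite mul1r.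
Qed.

Lemma theta_has_sum z : has_sum (theta_term z) (- theta tau z).
Proof. by rewrite /theta opprK; apply: sumZ_has_sum; exact: theta_term_summable. Qed.

(** In theta(x + y) theta(x - y), let m and n be the half-integers of the two
    factors, and put p = m + n and q = m - n. Then m^2 + n^2 = (p^2 + q^2) / 2
    and m (x + y) + n (x - y) = p x + q y, so each term splits into a factor in
    (p, x) and one in (q, y), both of the form
    exp (i pi tau p^2 / 2 + 2 i pi p x). The integers p and q have opposite
    parity; [even_term] and [odd_term] are this factor at 2 a and at 2 b + 1. *)
Definition even_term x := gauss (2 * (ipi * tau)) (4 * ipi * x) 0.
Definition odd_term x := gauss (2 * (ipi * tau)) (2 * (ipi * tau) + 4 * ipi * x)
  (ipi * tau / 2 + 2 * ipi * x).

Lemma even_term_summable x : abs_summable (even_term x).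
Proof.
apply: gauss_summable.
by have := @Re_ipitau 2 (ltr0n _ 2); rewrite rmorph_nat.
Qed.

Lemma odd_term_summable x : abs_summable (odd_term x).
Proof.
apply: gauss_summable.
by have := @Re_ipitau 2 (ltr0n _ 2); rewrite rmorph_nat.
Qed.

Lemma cexp_ipi : cexp ipi = -1.
Proof.
have -> : ipi = 0 +i* pi by rewrite /ipi; apply/eqP; rewrite eq_complex /=;
  apply/andP; split; apply/eqP; ring.
rewrite /cexp /= expR0 cospi sinpi mul1r.
by apply/eqP; rewrite eq_complex /= oppr0 !eqxx.
Qed.

Lemma cexp_2ipi (k : int) : cexp (k%:~R * (2 * ipi)) = 1.
Proof. by rewrite cexpMz cexpMn cexp_ipi sqrrN expr1n exp1rz. Qed.

Lemma mul_terms_even x y (a b : int) :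
  theta_term (x + y) (a + b) * theta_term (x - y) (a - b - 1) =
  even_term x a * odd_term y b.
Proof.
rewrite !theta_termE /even_term /odd_term /gauss -!cexpD.
rewrite -[RHS]mul1r -[X in _ = X * _](cexp_2ipi a) -cexpD; congr cexp.
by rewrite !(rmorphD, rmorphB, rmorph1) /=; field.
Qed.

Lemma mul_terms_odd x y (a b : int) :
  theta_term (x + y) (a + b) * theta_term (x - y) (b - a) =
  - (odd_term x b * even_term y a).
Proof.
rewrite !theta_termE /even_term /odd_term /gauss -!cexpD.
rewrite -[RHS]mulN1r -[X in _ = X * _]cexp_ipi -[RHS]mul1r.
rewrite -[X in _ = X * _](cexp_2ipi b) -!cexpD; congr cexp.
by rewrite !(rmorphD, rmorphB, rmorph1) /=; field.
Qed.

(** With p = j + k + 1 and q = j - k, the first copy lists the pairs (j, k) with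
    (p, q) = (2 a, 2 b + 1), and the second one, indexed by (b, a), those with
    (p, q) = (2 b + 1, 2 a). *)
Lemma bij_int2 : bijective (fun s : int * int + int * int => match s with
  | inl p => (p.1 + p.2, p.1 - p.2 - 1) | inr p => (p.2 + p.1, p.1 - p.2) end).
Proof.
exists (fun p => if (2 %| p.1 + p.2)%Z
  then inr (((p.1 + p.2) %/ 2)%Z, ((p.1 - p.2) %/ 2)%Z)
  else inl (((p.1 + p.2 + 1) %/ 2)%Z, ((p.1 - p.2 - 1) %/ 2)%Z)).
  case=> -[a b] /=; case: ifP => h.
  - by exfalso; lia.
  - by congr (inl (_, _)); lia.
  - by congr (inr (_, _)); lia.
  - by exfalso; lia.
by move=> [j k] /=; case: ifP => h /=; congr (_, _); lia.
Qed.

Definition even_series x := sumZ (even_term x).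
Definition odd_series x := sumZ (odd_term x).

(** The sign comes from the phase exp (i pi p), which is 1 for p even and -1 for
    p odd. *)
Lemma theta_mul x y : theta tau (x + y) * theta tau (x - y) =
  even_series x * odd_series y - odd_series x * even_series y.
Proof.
have he z := sumZ_has_sum (even_term_summable z).
have ho z := sumZ_has_sum (odd_term_summable z).
rewrite -[LHS]mulrNN; apply: has_sum_unique.
  by apply: has_sum_prod (theta_has_sum _) (theta_has_sum _);
    exact: theta_term_summable.
apply: (has_sum_reindex bij_int2); apply: has_sum_sumtype.
  have := has_sum_prod (even_term_summable x) (odd_term_summable y) (he x) (ho y).
  by apply: eq_has_sum => -[a b] /=; rewrite mul_terms_even.
have := has_sum_prod (odd_term_summable x) (even_term_summable y) (ho x) (he y).
move=> /(has_sumZ (-1)); rewrite mulN1r.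
by apply: eq_has_sum => -[b a] /=; rewrite mul_terms_odd mulN1r.
Qed.

(** By [theta_mul] the products theta(x + y) theta(x - y) are the minors of the
    matrix with rows [even_series] and [odd_series]. *)
Lemma theta_pluecker x y u v :
  (theta tau (x + u) * theta tau (x - u)) * (theta tau (y + v) * theta tau (y - v)) -
  (theta tau (y + u) * theta tau (y - u)) * (theta tau (x + v) * theta tau (x - v)) =
  (theta tau (x + y) * theta tau (x - y)) * (theta tau (u + v) * theta tau (u - v)).
Proof. by rewrite !theta_mul; ring. Qed.

End ThetaAddition.

(** * Power series and trigonometric series *)

Section TrigonometricSeries.
Context {R : realType}.
Local Notation C := R[i].

Lemma exp_sum_le (x : R) (B : seq nat) : 0 <= x -> uniq B ->
  \sum_(k <- B) x ^+ k / k`!%:R <= expR x.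
Proof.
move=> x0 uB.
have t0 k : 0 <= exp_coeff x k by rewrite /exp_coeff /= divr_ge0 ?exprn_ge0.
have sB : {subset B <= index_iota 0 (\max_(i <- B) i).+1}.
  by move=> i iB; rewrite mem_index_iota ltnS leq_bigmax_seq.
have uI : uniq (index_iota 0 (\max_(i <- B) i).+1) by exact: iota_uniq.
apply: le_trans (big_subset_le uB uI sB t0) _.
rewrite /expR; apply: (nondecreasing_cvgn_le (u_ := series (exp_coeff x))).
  by apply/nondecreasing_series => k _ _; exact: t0.
exact: is_cvg_series_exp_coeff.
Qed.

Definition cis_coeff (y : R) (k : nat) : C := ('i * y%:C) ^+ k / k`!%:R.

Lemma normc_nat (n : nat) : normc (n%:R : C) = n%:R.
Proof.
have -> : (n%:R : C) = (n%:R)%:C by rewrite rmorph_nat.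
by rewrite normcR ger0_norm.
Qed.

Lemma normcX (x : C) n : normc (x ^+ n) = normc x ^+ n.
Proof.
elim: n => [|n ih]; first by rewrite !expr0 -[1]/(1%:C) normcR normr1.
by rewrite !exprS normcM ih.
Qed.

Lemma normc_i : normc ('i : C) = 1.
Proof. by rewrite /= expr0n expr1n add0r sqrtr1. Qed.

Lemma normc_cis_coeff y k : normc (cis_coeff y k) = `|y| ^+ k / k`!%:R.
Proof.
by rewrite /cis_coeff normcM normcX normcM normc_i mul1r normcR normcV normc_nat.
Qed.

Lemma cis_coeff_summable y : abs_summable (cis_coeff y).
Proof.
exists (expR `|y|) => B uB; under eq_bigr do rewrite normc_cis_coeff.
exact: exp_sum_le.
Qed.

Lemma cis_coeffE y k : cis_coeff y k = cos_coeff y k +i* sin_coeff y k.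
Proof.
have sq : ('i : C) ^+ 2 = (-1)%:C by rewrite sqr_i rmorphN1.
have -> : cis_coeff y k = 'i ^+ k * (y ^+ k / k`!%:R)%:C.
  by rewrite /cis_coeff exprMn rmorphM rmorphXn fmorphV rmorph_nat mulrA.
rewrite /cos_coeff /sin_coeff /= -{1}(odd_double_half k) exprD -muln2 mulnC exprM sq.
rewrite -rmorphXn -!mulrA -[_%:C * _]rmorphM /=.
case: (boolP (odd k)) => ok /=.
  rewrite expr1 mul0r mul1r; have -> : k.-1./2 = k./2 by lia.
  by apply/eqP; rewrite eq_complex /=; apply/andP; split; apply/eqP; ring.
by rewrite expr0 !mul1r mul0r.
Qed.

Lemma cvg_ReIm (u : nat -> C) l : series u @ \oo --> l ->
  (series (fun k => complex.Re (u k)) @ \oo --> complex.Re l) /\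
  (series (fun k => complex.Im (u k)) @ \oo --> complex.Im l).
Proof.
move=> /cvgrPdist_lt h.
have {}h (e : R) : 0 < e -> \forall n \near \oo, normc (l - series u n) < e.
  move=> e0; have := h e%:C; rewrite ltcR => /(_ e0).
  by apply: filterS => n; rewrite normE ltcR.
have hRe n : complex.Re (series u n) = series (fun k => complex.Re (u k)) n.
  rewrite /series /=; by elim/big_rec2: _ => // k a b _ <-; rewrite ReD.
have hIm n : complex.Im (series u n) = series (fun k => complex.Im (u k)) n.
  by rewrite /series /=; elim/big_rec2: _ => // k a [? ?] _ <-; case: (u k).
split; apply/cvgrPdist_lt => e e0; near=> n.
  rewrite -hRe; apply: le_lt_trans (_ : normc (l - series u n) < e).
    by apply: le_trans (normc_geRe _); case: (l) (series u n) => ? ? [].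
  by near: n; exact: h.
rewrite -hIm; apply: le_lt_trans (_ : normc (l - series u n) < e).
  by apply: le_trans (normc_geIm _); case: (l) (series u n) => ? ? [].
by near: n; exact: h.
Unshelve. all: by end_near. Qed.

Lemma cexp_i (y : R) : cexp ('i * y%:C) = cos y +i* sin y.
Proof.
have -> : 'i * y%:C = 0 +i* y :> C.
  by apply/eqP; rewrite eq_complex /=; apply/andP; split; apply/eqP; ring.
by rewrite /cexp /= expR0 mul1r.
Qed.

Lemma cis_has_sum y : has_sum (cis_coeff y) (cexp ('i * y%:C)).
Proof.
have [l hl] := abs_has_sum (cis_coeff_summable y).
suff -> : cexp ('i * y%:C) = l by [].
have [hr hi] := cvg_ReIm (has_sum_cvg hl).
rewrite cexp_i; apply/eqP; rewrite eq_complex /=; apply/andP; split; apply/eqP.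
  rewrite cos.unlock; apply: (cvg_lim (@Rhausdorff R)).
  by under [cos_coeff y]funext => k do
    rewrite -[cos_coeff y k]/(complex.Re (_ +i* sin_coeff y k)) -cis_coeffE.
rewrite sin.unlock; apply: (cvg_lim (@Rhausdorff R)).
by under [sin_coeff y]funext => k do
  rewrite -[sin_coeff y k]/(complex.Im (cos_coeff y k +i* _)) -cis_coeffE.
Qed.

End TrigonometricSeries.

Section IdentityTheorem.
Context {R : realType}.
Local Notation C := R[i].

Lemma has_sum_bounded (I : eqType) (u : I -> C) l :
  has_sum u l -> exists2 M, 0 <= M & forall k, normc (u k) <= M.
Proof.
move=> h; have [A hA] := h 1 ltr01; pose A' := undup A.
have uA : uniq A' by exact: undup_uniq.
have sA : {subset A <= A'} by move=> x; rewrite mem_undup.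
have S0 : 0 <= \sum_(i <- A') normc (u i) by apply: sumr_ge0 => i _; exact: normc_ge0.
exists (2 + \sum_(i <- A') normc (u i)) => [|k]; first by lra.
have [kA|kA] := boolP (k \in A').
  rewrite (bigD1_seq k) //=.
  have : 0 <= \sum_(i <- A' | i != k) normc (u i).
    by apply: sumr_ge0 => i _; exact: normc_ge0.
  by lra.
have h1 := hA A' uA sA.
have h2 : normc (\sum_(i <- k :: A') u i - l) < 1.
  apply: hA; first by rewrite /= kA.
  by move=> x /sA xA; rewrite inE xA orbT.
have -> : u k = (\sum_(i <- k :: A') u i - l) - (\sum_(i <- A') u i - l).
  by rewrite big_cons; ring.
by apply: le_trans (normc_triangle _ _) _; rewrite normc_opp; lra.
Qed.

(** If the coefficients below the k-th vanish, then the term of degree k is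
    minus the sum of the terms of higher degree, which is O(s^(k+1)); dividing
    by s^k and letting s tend to 0 gives t_k = 0. *)
Lemma power_series_zero (t : nat -> C) (r : R) : 0 < r ->
  (forall s : R, `|s| < r -> has_sum (fun k => s%:C ^+ k * t k) 0) ->
  forall k, t k = 0.
Proof.
(* Convergence at s0 only bounds the terms; halving s0 makes them summable. *)
move=> r0 h; pose s0 := r / 2; pose s1 := s0 / 2.
have s0_gt0 : 0 < s0 by rewrite /s0; lra.
have s1_gt0 : 0 < s1 by rewrite /s1; lra.
have [|M M0 hM] := @has_sum_bounded _ _ _ (h s0 _).
  by rewrite gtr0_norm// /s0; lra.
have : abs_summable (fun k => s1%:C ^+ k * t k).
  have h12 : 0 <= (2^-1 : R) < 1 by lra.
  apply: abs_summable_le (abs_summableZ M%:C (abs_summable_geometric h12)) => k.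
  have := hM k; rewrite !normcM !normcX !normcR (ger0_norm M0).
  rewrite !gtr0_norm ?exprn_gt0 ?invr_gt0// => hk; rewrite /s1 exprMn mulrAC.
  by rewrite ler_wpM2r ?exprn_ge0 ?invr_ge0//.
move=> [N hN]; elim/ltn_ind => k ih.
apply: eq0_normc; apply/eqP; rewrite eq_le normc_ge0 andbT.
have N0 : 0 <= N by have := hN [::] isT; rewrite big_nil.
have bnd (s : R) : 0 < s <= s1 -> normc (t k) <= s * (N / s1 ^+ k.+1).
  move=> /andP[s_gt0 s_le].
  have sr : `|s| < r by rewrite gtr0_norm//; rewrite /s1 /s0 in s_le; lra.
  have hs := has_sumD (h s sr) (has_sum_single k (- (s%:C ^+ k * t k))).
  have : normc (0 - s%:C ^+ k * t k) <= (s / s1) ^+ k.+1 * N.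
    apply: (has_sum_le hs) => B uB; apply: le_trans (_ : _ <= \sum_(l <- B)
        (s / s1) ^+ k.+1 * normc (s1%:C ^+ l * t l)) _; last first.
      by rewrite -mulr_sumr ler_wpM2l ?hN// exprn_ge0// ltW// divr_gt0.
    apply: ler_sum => l _; have [->|lk] := eqVneq l k.
      rewrite subrr normc0 mulr_ge0 ?normc_ge0 ?exprn_ge0//.
      by rewrite ltW// divr_gt0.
    rewrite addr0; have [lk'|kl] := ltnP l k.
      by rewrite ih// !mulr0 normc0 mulr0.
    have {lk kl}kl : (k < l)%N by rewrite ltn_neqAle eq_sym lk.
    rewrite !normcM !normcX !normcR !gtr0_norm// mulrA ler_wpM2r ?normc_ge0//.
    have {1}-> : s = (s / s1) * s1 by rewrite divfK// gt_eqF.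
    rewrite exprMn; apply: ler_wpM2r; first by rewrite exprn_ge0// ltW.
    have q0 : 0 <= s / s1 by rewrite ltW// divr_gt0.
    have q1 : s / s1 <= 1 by rewrite ler_pdivrMr// mul1r.
    by rewrite -(subnK kl) exprD ler_piMl ?exprn_ge0// exprn_ile1.
  rewrite sub0r normc_opp normcM normcX normcR gtr0_norm// expr_div_n exprSr.
  rewrite -!mulrA ler_pM2l ?exprn_gt0//.
  by rewrite (mulrC _ N).
apply/ler_addgt0Pl => e e0; rewrite addr0.
pose K := N / s1 ^+ k.+1.
have K0 : 0 <= K by rewrite divr_ge0// exprn_ge0// ltW.
pose s := Num.min s1 (e / (K + 1)).
have eK : 0 < e / (K + 1) by rewrite divr_gt0//; lra.
have sP : 0 < s <= s1 by rewrite /s lt_min s1_gt0 eK ge_min lexx.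
apply: le_trans (bnd s sP) _; rewrite -/K.
have s_le : s <= e / (K + 1) by rewrite /s ge_min lexx orbT.
apply: le_trans (_ : e / (K + 1) * K <= _).
  by rewrite ler_wpM2r.
rewrite mulrAC ler_pdivrMr; last by lra.
by rewrite ler_pM2l//; lra.
Qed.

Lemma bij_swap (I J : Type) : bijective (fun p : I * J => (p.2, p.1)).
Proof. by exists (fun p : J * I => (p.2, p.1)); case. Qed.

(** The decay of [c] makes the double series of terms c_j (i a_j s)^k / k!
    absolutely summable. Summed over k first it gives the trigonometric series;
    summed over j first it gives a power series in s that converges everywhere.
    The latter vanishes near 0, hence has zero coefficients. *)
Lemma trig_series_zero (I : eqType) (c : I -> C) (a : I -> R) (r : R) : 0 < r ->
  (forall S : R, abs_summable (fun j => (normc (c j) * expR (S * `|a j|))%:C)) ->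
  (forall s : R, `|s| < r -> has_sum (fun j => c j * cexp ('i * (a j * s)%:C)) 0) ->
  forall s : R, has_sum (fun j => c j * cexp ('i * (a j * s)%:C)) 0.
Proof.
move=> r0 hc h; pose F (s : R) (p : I * nat) := c p.1 * cis_coeff (a p.1 * s) p.2.
have sF s : abs_summable (F s).
  have [M hM] := hc `|s|.
  apply: (@abs_summable_pair _ _ _ _ (fun j => normc (c j) * expR (`|s| * `|a j|)) M).
    move=> j B uB; rewrite /F /=.
    under eq_bigr do rewrite normcM normc_cis_coeff.
    rewrite -mulr_sumr ler_wpM2l ?normc_ge0// mulrC -normrM.
    exact: exp_sum_le.
  move=> B uB; apply: le_trans (hM B uB); apply: ler_sum => j _.
  by rewrite normcR; exact: ler_norm.
have rows s j : has_sum (fun k => F s (j, k)) (c j * cexp ('i * (a j * s)%:C)).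
  by rewrite /F /=; apply: has_sumZ; exact: cis_has_sum.
have /choice[t ht] : forall k, exists tk, has_sum (fun j => F 1 (j, k)) tk.
  move=> k; apply: abs_has_sum.
  by apply: (abs_summable_comp (h := fun j => (j, k)) _ (sF 1)) => x y [].
have cols s k : has_sum (fun j => F s (j, k)) (s%:C ^+ k * t k).
  apply: eq_has_sum (has_sumZ _ (ht k)) => j; rewrite /F /cis_coeff /=.
  rewrite mulr1 rmorphM /=; set z := (k`!%:R)^-1.
  by rewrite !exprMn; ring.
have total s G : has_sum (F s) G -> has_sum (fun k => s%:C ^+ k * t k) G.
  move=> hG; apply: (has_sum_rows (F := fun p => F s (p.2, p.1)) (cols s)).
  apply: (has_sum_reindex (@bij_swap _ _)).
  by apply: eq_has_sum hG => -[].
have t0 : forall k, t k = 0.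
  apply: (power_series_zero r0) => s sr.
  have [G hG] := abs_has_sum (sF s).
  have := has_sum_rows (rows s) hG => /(has_sum_unique (h s sr)) G0.
  by rewrite G0; exact: total.
move=> s; have [G hG] := abs_has_sum (sF s).
have -> : 0 = G; last exact: has_sum_rows (rows s) hG.
apply: has_sum_unique (total _ _ hG); apply: eq_has_sum (@has_sum0 _ _) => k.
by rewrite t0 mulr0.
Qed.

End IdentityTheorem.

(** * Zeros and continuity of theta *)

Section ThetaZeros.
Context {R : realType}.
Local Notation C := R[i].
Variable tau : C.
Hypothesis tau_gt0 : 0 < complex.Im tau.

Definition freq (j : int) : R := 2 * pi * (j%:~R + 2^-1).

Lemma theta_term_shift z h j :
  theta_term tau (z + h) j = theta_term tau z j * cexp ('i * (freq j)%:C * h).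
Proof.
rewrite /theta_term -cexpD; congr cexp.
rewrite /freq !(rmorphM, rmorphD, fmorphV, rmorph_nat, rmorph_int) /=.
ring.
Qed.

Lemma expR_abs_le (x : R) : expR `|x| <= expR x + expR (- x).
Proof.
have := expR_ge0 x; have := expR_ge0 (- x).
by case: (ger0P x) => _; lra.
Qed.

Lemma normc_norm_summable (I : eqType) (u : I -> C) :
  abs_summable u -> abs_summable (fun j => (normc (u j))%:C).
Proof.
apply: abs_summable_le => j; rewrite normcR ger0_norm//; exact: normc_ge0.
Qed.

(** Multiplying the terms by exp (e freq j) amounts to an imaginary translation
    of z. *)
Lemma theta_term_exp_summable z (S : R) : abs_summable
  (fun j => (normc (theta_term tau z j) * expR (S * `|freq j|))%:C).
Proof.
have G (e : R) : abs_summable (fun j => theta_term tau z j * cexp (e * freq j)%:C).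
  have -> : (fun j => theta_term tau z j * cexp (e * freq j)%:C) =
      theta_term tau (z - 'i * e%:C).
    apply/funext => j; rewrite theta_term_shift; congr (_ * cexp _).
    rewrite rmorphM /= mulrN mulrACA -expr2 sqr_i.
    ring.
  exact: theta_term_summable.
have := abs_summableD (normc_norm_summable (G S)) (normc_norm_summable (G (- S))).
apply: abs_summable_le => j.
set t := theta_term tau z j; set f := freq j; have t0 := normc_ge0 t.
rewrite !(normcM t) !normc_cexp -rmorphD !normcR /=.
apply: le_trans (ler_norm _); rewrite ger0_norm ?mulr_ge0 ?expR_ge0//.
rewrite -mulrDr ler_wpM2l// mulNr.
apply: le_trans (expR_abs_le (S * f)); rewrite ler_expR (normrM S).
by rewrite ler_wpM2r// ler_norm.
Qed.

Lemma sum_root_unity (j : int) (N : nat) : j != 0 -> (`|j| < N)%N ->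
  \sum_(k < N) cexp ('i * (2 * pi * j%:~R / N%:R)%:C) ^+ k = 0 :> C.
Proof.
move=> j0 jN; set x : R := pi * j%:~R / N%:R.
have N0 : 0 < N%:R :> R by rewrite ltr0n; lia.
have sx : sin x != 0.
  have ax : 0 < `|x| < pi.
    rewrite /x -mulrA normrM gtr0_norm ?pi_gt0// normrM normfV.
    rewrite (gtr0_norm N0) -intr_norm -natr_absz.
    have j1 : 0 < (`|j|%N)%:R :> R by rewrite ltr0n absz_gt0.
    rewrite !mulr_gt0 ?pi_gt0 ?invr_gt0//= gtr_pMr ?pi_gt0//.
    by rewrite ltr_pdivrMr// mul1r ltr_nat.
  have := sin_gt0_pi ax; case: (ger0P x) => _; first by move/gt_eqF ->.
  by rewrite sinN oppr_gt0 => /lt_eqF ->.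
have -> : 2 * pi * j%:~R / N%:R = x + x by rewrite /x; field; rewrite gt_eqF.
set z := cexp _.
have zN : z ^+ N = 1.
  rewrite /z -cexpMn -[RHS](cexp_2ipi j); congr cexp.
  rewrite /x !(rmorphM, rmorphD, fmorphV, rmorph_nat, rmorph_int) /=.
  by field; rewrite pnatr_eq0; lia.
have z1 : z != 1.
  apply: contra sx => /eqP; rewrite /z cexp_i => -[+ _].
  rewrite cosD -!expr2 => h; have := cos2Dsin2 x => h'.
  by rewrite -sqrf_eq0; apply/eqP; lra.
have := subrX1 z N; rewrite zN subrr => /esym/eqP.
by rewrite mulf_eq0 subr_eq0 (negbTE z1) => /eqP.
Qed.

(** Averaging the series at s = k / N against exp (- i pi k / N), for k < N,
    multiplies c_j by the mean of the powers of exp (2 i pi j / N). This mean is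
    1 for j = 0 and 0 for 0 < |j| < N; for N large, the other indices lie in a
    tail of [c]. *)
Lemma trig_series_coeff0 (c : int -> C) : abs_summable c ->
  (forall s : R, has_sum (fun j => c j * cexp ('i * (freq j * s)%:C)) 0) ->
  c 0 = 0.
Proof.
move=> sc h; apply: eq0_normc; apply/eqP; rewrite eq_le normc_ge0 andbT.
apply/ler_addgt0Pl => e e0; rewrite addr0.
have [A hA] := abs_summable_tail sc e0.
pose N := (\max_(j <- A) `|j|%N).+1.
have N0 : (N%:R : C) != 0 by rewrite pnatr_eq0.
pose av j : C := N%:R^-1 * \sum_(k < N) cexp ('i * (2 * pi * j%:~R / N%:R)%:C) ^+ k.
have hav : has_sum (fun j => c j * av j) 0.
  have := has_sum_sum (index_enum 'I_N) (fun k : 'I_N =>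
    has_sumZ (N%:R^-1 * cexp (- ('i * (pi * k%:R / N%:R)%:C)))
      (h (k%:R / N%:R))).
  rewrite big1 => [|k _]; last by rewrite mulr0.
  apply: eq_has_sum => j; rewrite /av !mulr_sumr; apply: eq_bigr => k _.
  have -> : cexp ('i * (2 * pi * j%:~R / N%:R)%:C) ^+ k =
      cexp (- ('i * (pi * k%:R / N%:R)%:C)) * cexp ('i * (freq j * (k%:R / N%:R))%:C).
    rewrite -cexpMn -cexpD; congr cexp.
    rewrite /freq !(rmorphM, rmorphD, fmorphV, rmorph_nat, rmorph_int) /=.
    by field.
  by ring.
have av0 : av 0 = 1.
  rewrite /av; under eq_bigr do rewrite mulr0 mul0r mulr0 cexp0 expr1n.
  by rewrite sumr_const card_ord mulVf.
have av_le j : normc (av j) <= 1.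
  rewrite /av normcM normcV normc_nat mulrC ler_pdivrMr ?ltr0n// mul1r.
  apply: le_trans (normc_sum _ _) _.
  apply: le_trans (_ : \sum_(k < N) (1 : R) <= _); last by rewrite sumr_const card_ord.
  apply: ler_sum => k _; rewrite normcX cexp_i /= cos2Dsin2 sqrtr1 expr1n//.
have := has_sumD hav (has_sum_single 0 (- c 0)); rewrite add0r => hs.
rewrite -normc_opp; apply: (has_sum_le hs) => B uB.
rewrite (bigID (fun j => (j == 0) || (j \in A))) /= big1 ?add0r => [|j].
  have hB := hA [seq j <- B | ~~ ((j == 0) || (j \in A))] (filter_uniq _ uB).
  apply: le_trans (hB _); last first.
    by move=> j; rewrite mem_filter negb_or => /andP[/andP[]].
  rewrite big_filter; apply: ler_sum => j; rewrite negb_or => /andP[/negbTE -> _].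
  by rewrite addr0 normcM ler_piMr ?normc_ge0.
case: eqVneq => [-> _|j0 /= jA]; first by rewrite av0 mulr1 subrr normc0.
rewrite /av sum_root_unity ?mulr0 ?addr0 ?normc0//.
by rewrite ltnS; apply: (@leq_bigmax_seq _ _ _ absz).
Qed.

Lemma theta_neq0_near (p : C) (r : R) : 0 < r ->
  exists2 s : R, `|s| < r & theta tau (p + s%:C) != 0.
Proof.
move=> r0; apply: contrapT => nex.
have vanish (s : R) : `|s| < r -> theta tau (p + s%:C) = 0.
  by move=> sr; apply/eqP/negP => /negP ne; apply: nex; exists s.
have : theta_term tau p 0 = 0.
  apply: trig_series_coeff0; first exact: theta_term_summable.
  apply: (trig_series_zero r0); first exact: theta_term_exp_summable.
  move=> s /vanish e; have := theta_has_sum tau_gt0 (p + s%:C).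
  rewrite e oppr0; apply: eq_has_sum => j.
  by rewrite theta_term_shift; congr (_ * cexp _);
  rewrite (rmorphM _ (freq j)) /=; ring.
by move/eqP; rewrite (negbTE (cexp_neq0 _)).
Qed.

(** With u = x + i y, each of exp x - 1 and exp (i y) - 1 is bounded by the real
    exponential of an absolute value minus 1. *)
Lemma normc_cexp_sub1 (u : C) :
  normc (cexp u - 1) <= 2 * normc u * expR (2 * normc u).
Proof.
set x := complex.Re u; set y := complex.Im u.
have xle : `|x| <= normc u by exact: normc_geRe.
have yle : `|y| <= normc u by exact: normc_geIm.
have hx : `|expR x - 1| <= expR `|x| - 1.
  case: (ger0P x) => x0.
    by have := expR_ge1Dx x => h; rewrite ger0_norm; lra.
  have h1 : expR x < 1 by rewrite expR_lt1.
  have h2 : expR x * expR (- x) = 1 by exact: expRxMexpNx_1.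
  have h3 := expR_ge1Dx (- x); have h4 := expR_gt0 x.
  by rewrite ler0_norm; nra.
have hy : normc (cexp ('i * y%:C) - 1) <= expR `|y| - 1.
  have hs := has_sumD (cis_has_sum y) (has_sum_single 0%N (-1)).
  apply: (has_sum_le hs) => B uB.
  have uB0 : uniq (0%N :: [seq k <- B | k != 0%N]).
    by rewrite /= mem_filter eqxx filter_uniq.
  have := exp_sum_le (normr_ge0 y) uB0; rewrite big_cons expr0 fact0 divr1.
  rewrite -lerBrDl; apply: le_trans.
  rewrite (bigID (pred1 0%N)) /= big1 ?add0r => [|k /eqP ->]; last first.
    by rewrite eqxx /cis_coeff expr0 fact0 divr1 subrr normc0.
  rewrite big_filter; apply: ler_sum => k /negbTE ->.
  by rewrite addr0 normc_cis_coeff.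
have -> : cexp u - 1 =
    (expR x)%:C * (cexp ('i * y%:C) - 1) + (expR x - 1)%:C.
  have -> : u = x%:C + 'i * y%:C by rewrite -complexE.
  by rewrite cexpD cexp_real rmorphB /=; ring.
apply: le_trans (normc_triangle _ _) _.
rewrite normcM !normcR (gtr0_norm (expR_gt0 _)).
have h5 : expR x <= expR `|x| by rewrite ler_expR ler_norm.
have h6 : 1 <= expR `|y| by have := expR_ge1Dx `|y|; have := normr_ge0 y; lra.
have h7 : expR `|x| * expR `|y| <= expR (2 * normc u).
  by rewrite -expRD ler_expR; lra.
apply: le_trans (_ : expR (2 * normc u) - 1 <= _).
  have h8 : expR x * normc (cexp ('i * y%:C) - 1) <= expR `|x| * (expR `|y| - 1).
    by apply: ler_pM h5 hy; [exact: expR_ge0 | exact: normc_ge0].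
  by rewrite mulrBr mulr1 in h8; lra.
set v := 2 * normc u; have := expR_ge1Dx (- v).
have : expR v * expR (- v) = 1 by exact: expRxMexpNx_1.
by have := expR_gt0 v; nra.
Qed.

(** Theta is locally Lipschitz: for |h| <= 1 a translation by h changes the j-th
    term by a factor within |h| exp (4 |freq j|) of 1. *)
Lemma theta_continuous : continuous (theta tau : C -> C).
Proof.
move=> z; have [K hK] := theta_term_exp_summable z 4.
have K0 : 0 <= K by have := hK [::] isT; rewrite big_nil.
have lip (h : C) : normc h <= 1 ->
    normc (theta tau z - theta tau (z + h)) <= K * normc h.
  move=> h1; have hs := has_sumD (theta_has_sum tau_gt0 (z + h))
    (has_sumZ (-1) (theta_has_sum tau_gt0 z)).
  have -> : theta tau z - theta tau (z + h) = - theta tau (z + h) + -1 * - theta tau z.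
    by ring.
  apply: (has_sum_le hs) => B uB.
  apply: le_trans (_ : normc h * \sum_(j <- B)
    normc (normc (theta_term tau z j) * expR (4 * `|freq j|))%:C <= _); last first.
    by rewrite mulrC ler_wpM2r ?normc_ge0 ?hK.
  rewrite mulr_sumr; apply: ler_sum => j _.
  rewrite theta_term_shift; set t := theta_term tau z j; set f := freq j.
  have -> : t * cexp ('i * f%:C * h) + -1 * t = t * (cexp ('i * f%:C * h) - 1) by ring.
  have t0 := normc_ge0 t; have h0 := normc_ge0 h.
  rewrite normcM normcR ger0_norm ?mulr_ge0 ?expR_ge0// mulrCA ler_wpM2l//.
  apply: le_trans (normc_cexp_sub1 _) _.
  rewrite !normcM normc_i mul1r normcR.
  have f0 := normr_ge0 f; set F := `|f| in f0 *.
  have e1 : expR (2 * (F * normc h)) <= expR (2 * F).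
    by rewrite ler_expR; nra.
  have e2 := expR_ge1Dx (2 * F).
  have -> : expR (4 * F) = expR (2 * F) * expR (2 * F) by rewrite -expRD; congr expR; ring.
  have e3 := expR_gt0 (2 * (F * normc h)).
  apply: le_trans (_ : normc h * (2 * F * expR (2 * (F * normc h))) <= _).
    by rewrite le_eqVlt; apply/orP; left; apply/eqP; ring.
  rewrite ler_wpM2l// ler_pM ?expR_ge0 ?mulr_ge0//; lra.
apply/(@cvgrPdist_lt _ _ _ (nbhs z)) => e; rewrite ltcE /= => /andP[/eqP ie re].
pose d := Num.min 1 (complex.Re e / (K + 1)).
have d0 : 0 < d by rewrite lt_min ltr01 divr_gt0//; lra.
have : nbhs z (ball z (d%:C : C)) by apply: nbhsx_ballx; rewrite ltcR.
apply: filterS => z' /=; rewrite -ball_normE /= normE ltcR normc_sub => hz.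
rewrite normE ltcE /= ie eqxx /=.
have := lip (z' - z); rewrite (addrC z) subrK => hl.
apply: le_lt_trans (hl _) _.
  by apply: ltW; apply: lt_le_trans hz _; rewrite ge_min lexx.
have : d <= complex.Re e / (K + 1) by rewrite ge_min lexx orbT.
rewrite ler_pdivlMr; last by lra.
have := normc_ge0 (z' - z); nra.
Qed.

End ThetaZeros.

(** * Oddness and generic nonvanishing *)

Section OpenDense.
Context {R : realType}.
Local Notation C := R[i].
Variable tau : C.
Hypothesis tau_gt0 : 0 < complex.Im tau.

(** The right-hand side of [theta_mul] is antisymmetric in x and y, so
    theta(c) theta(x) = - theta(c) theta(- x) for all c. *)
Lemma theta_opp x : theta tau (- x) = - theta tau x.
Proof.
have [c c0] : exists c, theta tau c != 0.
  have [s _ h] := theta_neq0_near tau_gt0 0 ltr01.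
  by exists (0 + s%:C).
apply: (mulfI c0).
have h1 := theta_mul tau_gt0 ((c + x) / 2) ((c - x) / 2).
have h2 := theta_mul tau_gt0 ((c - x) / 2) ((c + x) / 2).
have e1 : (c + x) / 2 + (c - x) / 2 = c by field.
have e2 : (c + x) / 2 - (c - x) / 2 = x by field.
have e3 : (c - x) / 2 + (c + x) / 2 = c by field.
have e4 : (c - x) / 2 - (c + x) / 2 = - x by field.
rewrite e1 e2 in h1; rewrite e3 e4 in h2.
by rewrite h2 [RHS]mulrN h1; ring.
Qed.

Lemma open_dense_fin (T : topologicalType) (I : finType) (P : I -> set T) :
  (forall i, open (P i) /\ dense (P i)) ->
  open [set x | forall i, P i x] /\ dense [set x | forall i, P i x].
Proof.
move=> h; pose Q (r : seq I) := \big[setI/setT]_(i <- r) P i.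
have -> : [set x | forall i, P i x] = Q (index_enum I).
  rewrite /Q; apply/seteqP; split=> x /=.
    by move=> hx; elim/big_rec: _ => // i S _; split.
  suff : forall r, Q r x -> forall i, i \in r -> P i x.
    by move=> H /H hx i; apply: hx; rewrite mem_index_enum.
  rewrite /Q; elim=> // i r ih; rewrite big_cons => -[hi /ih hr] j.
  by rewrite inE => /orP[/eqP ->|/hr].
rewrite /Q; elim: (index_enum I) => [|i r [oQ dQ]].
  by rewrite big_nil; split; [exact: openT | move=> O; rewrite setIT].
rewrite big_cons; have [oP dP] := h i; split; first exact: openI.
exact: denseI.
Qed.

(** The slope condition makes real multiples of [v] move [l x] along a horizontal
    segment, on which theta does not vanish identically. *)
Lemma theta_neq0_open_dense (V : normedModType C) (l : V -> C) (v : V) :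
  continuous l -> (forall x t, l (x + t *: v) = l x + t) ->
  open [set x | theta tau (l x) != 0] /\ dense [set x | theta tau (l x) != 0].
Proof.
move=> cl lv; split.
  have -> : [set x | theta tau (l x) != 0] = (theta tau \o l) @^-1` (~` [set 0]).
    by apply/seteqP; split => x /=; [move/eqP | move/eqP].
  apply: open_comp; last by apply: closed_openC;
    exact/accessible_closed_set1/hausdorff_accessible/norm_hausdorff.
  move=> x _; apply: continuous_comp; [exact: cl | exact: theta_continuous].
move=> O [x Ox] oO.
have ct : continuous (fun t : C => x + t *: v).
  move=> t; apply: (@cvgD C V C (nbhs t) _ (fun=> x) (fun u : C => u *: v) x (t *: v)).
    exact: cvg_cst.
  exact: scalel_continuous.
have : nbhs (0 : C) ((fun t : C => x + t *: v) @^-1` O).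
  apply: ct; rewrite scale0r addr0; exact: open_nbhs_nbhs.
move=> /nbhs_ballP[e /= ]; rewrite ltcE => /andP[/eqP /= ie re] he.
have [s sr hs] := theta_neq0_near tau_gt0 (l x) re.
exists (x + s%:C *: v); split; last by rewrite /= lv.
apply: (he s%:C); rewrite -ball_normE; rewrite /ball_ /mkset sub0r normE normc_opp normcR.
by rewrite ltcE /= ie eqxx.
Qed.

End OpenDense.

(** * The operators in separated variables *)

Section SeparatedOperators.
Context {R : realType} {n : nat}.
Local Notation C := R[i].
Variables (tau eta : C) (zs : 'I_n -> C) (Lam : 'I_n -> nat) (vartheta : C).
Hypothesis tau_gt0 : 0 < complex.Im tau.
Implicit Types (x : 'rV[C]_n) (i j : 'I_n).

Local Notation theta := (theta tau).

(** The coefficient shared by the lowering and the raising shift of [x_i]: on S1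
    the argument - lambda + z + x_i - 2 s of the latter is lambda + z + x_i. *)
Definition kernel (z : C) x i : C :=
  theta (- sum_xz zs x + z + x 0 i) / theta (- sum_xz zs x) *
  \prod_(j < n | j != i) (theta (z + x 0 j) / theta (x 0 i - x 0 j)).

Definition step (lower : bool) : C := if lower then - (2 * eta) else 2 * eta.

(** The same function for all indices i, evaluated at x_i alone: this is what
    separates the variables. *)
Definition amplitude (lower : bool) (u : C) : C :=
  if lower then - Delta_plus tau eta zs Lam (- u)
  else - (vartheta * Delta_minus tau eta zs Lam (- u)).

Definition translate i (a : C) x : 'rV[C]_n := x + a *: delta_mx 0 i.

Lemma T_S1E z f x : T_S1 tau eta zs Lam vartheta z f x =
  \sum_(p : 'I_n * bool)
    kernel z x p.1 * amplitude p.2 (x 0 p.1) * f (translate p.1 (step p.2) x).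
Proof.
rewrite -(pair_bigA _ (fun i o => kernel z x i * amplitude o (x 0 i) *
  f (translate i (step o) x))) /=.
under [RHS]eq_bigr do rewrite big_bool.
rewrite big_split /= /T_S1 /restrict_S1 /T_op /b_op /c_op; congr (_ + _).
  rewrite -sumrN; apply: eq_bigr => i _.
  rewrite /kernel /amplitude /step /= /shift_x /shift_lambda /extend_S1 /=.
  by rewrite /translate; ring.
rewrite -sumrN mulr_sumr; apply: eq_bigr => i _.
rewrite /kernel /amplitude /step /= /shift_x /shift_lambda /extend_S1 /=.
have -> : - - sum_xz zs x + z + x 0 i - 2 * sum_xz zs x =
  - sum_xz zs x + z + x 0 i by ring.
by rewrite /translate; ring.
Qed.

Lemma translate_same i a x : translate i a x 0 i = x 0 i + a.
Proof. by rewrite !mxE !eqxx mulr1. Qed.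

Lemma translate_other i j a x : j != i -> translate i a x 0 j = x 0 j.
Proof. by move=> /negbTE ji; rewrite !mxE ji andbF mulr0 addr0. Qed.

Lemma translateC i j a b x : translate i a (translate j b x) = translate j b (translate i a x).
Proof. by rewrite /translate addrAC. Qed.

Lemma sum_translate i a x : sum_xz zs (translate i a x) = sum_xz zs x + a.
Proof.
rewrite /sum_xz (bigD1 i) //= [in RHS](bigD1 i) //= translate_same.
under eq_bigr => j ji do rewrite translate_other//.
by ring.
Qed.

(** The difference x_i - s and the x_j with j != i do not change when x_i is
    translated, so the z-dependent factors of [kernel z x i] do not either. *)
Lemma kernel_same z w x i a :
  kernel z x i * kernel w (translate i a x) i = kernel w x i * kernel z (translate i a x) i.
Proof.
pose num u := theta (- sum_xz zs x + u + x 0 i) * \prod_(j < n | j != i) theta (u + x 0 j).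
pose den y := theta (- sum_xz zs y) * \prod_(j < n | j != i) theta (y 0 i - y 0 j).
have k1 u : kernel u x i = num u / den x.
  by rewrite /kernel prodf_div mulf_div.
have k2 u : kernel u (translate i a x) i = num u / den (translate i a x).
  rewrite /kernel prodf_div mulf_div; congr (_ * _ / _).
    by rewrite sum_translate translate_same; congr theta; ring.
  by apply: eq_bigr => j ji; rewrite translate_other.
rewrite !k1 !k2; move: (num z) (num w) (den x) (den _) => A B D E.
by rewrite mulrACA (mulrC A) mulrACA.
Qed.

Lemma kernel_split z x i j : i != j -> kernel z x i =
  theta (- sum_xz zs x + z + x 0 i) * theta (z + x 0 j) /
    (theta (- sum_xz zs x) * theta (x 0 i - x 0 j)) *
  \prod_(k < n | (k != i) && (k != j)) (theta (z + x 0 k) / theta (x 0 i - x 0 k)).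
Proof.
by move=> ij; rewrite /kernel (bigD1 j) 1?eq_sym//= mulrA mulf_div.
Qed.

(** As functions of z, theta(- s + z + u) theta(z + v) and
    theta(- (s + a) + z + v) theta(z + (u + a)) have the same sum of zeros, so
    they lie in a two-dimensional space and their antisymmetrization in z and w
    is a multiple of a fixed function. Up to sign the factor is the denominator
    that the second kernel brings, which removes the dependence on a. *)
Lemma theta_exchange (s u v a z w : C) :
  theta (- s + z + u) * theta (z + v) *
    (theta (- (s + a) + w + v) * theta (w + (u + a))) -
  theta (- s + w + u) * theta (w + v) *
    (theta (- (s + a) + z + v) * theta (z + (u + a))) =
  theta (z - w) * theta (z + w + u + v - s) *
    (theta (- (s + a)) * - theta (v - (u + a))).
Proof.
(* Centering z and w at (s - u - v) / 2 writes both products in the form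
   theta(x + y) theta(x - y). *)
have := theta_pluecker tau_gt0 (z + (u + v - s) / 2) (w + (u + v - s) / 2)
  ((u - v - s) / 2) ((v - u - s - 2 * a) / 2).
rewrite -theta_opp//.
have -> : z + (u + v - s) / 2 + (u - v - s) / 2 = - s + z + u by field.
have -> : z + (u + v - s) / 2 - (u - v - s) / 2 = z + v by field.
have -> : w + (u + v - s) / 2 + (u - v - s) / 2 = - s + w + u by field.
have -> : w + (u + v - s) / 2 - (u - v - s) / 2 = w + v by field.
have -> : z + (u + v - s) / 2 + (v - u - s - 2 * a) / 2 = - (s + a) + z + v by field.
have -> : z + (u + v - s) / 2 - (v - u - s - 2 * a) / 2 = z + (u + a) by field.
have -> : w + (u + v - s) / 2 + (v - u - s - 2 * a) / 2 = - (s + a) + w + v by field.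
have -> : w + (u + v - s) / 2 - (v - u - s - 2 * a) / 2 = w + (u + a) by field.
have -> : z + (u + v - s) / 2 + (w + (u + v - s) / 2) = z + w + u + v - s by field.
have -> : z + (u + v - s) / 2 - (w + (u + v - s) / 2) = z - w by field.
have -> : (u - v - s) / 2 + (v - u - s - 2 * a) / 2 = - (s + a) by field.
have -> : (u - v - s) / 2 - (v - u - s - 2 * a) / 2 = - (v - (u + a)) by field.
by move=> ->; rewrite [theta (z + w + u + v - s) * _]mulrC.
Qed.

Lemma kernel_translate_split w x i j a : i != j -> kernel w (translate i a x) j =
  theta (- (sum_xz zs x + a) + w + x 0 j) * theta (w + (x 0 i + a)) /
    (theta (- (sum_xz zs x + a)) * theta (x 0 j - (x 0 i + a))) *
  \prod_(k < n | (k != i) && (k != j)) (theta (w + x 0 k) / theta (x 0 j - x 0 k)).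
Proof.
move=> ij; have ji : j != i by rewrite eq_sym.
rewrite (kernel_split _ _ ji) sum_translate translate_same translate_other//; congr (_ * _).
rewrite (eq_bigl (fun k => (k != i) && (k != j))) => [|k]; last by rewrite andbC.
by apply: eq_bigr => k /andP[ki _]; rewrite translate_other.
Qed.

(** [A] and [B] are the numerators of the two orders of the shifts. Both defects
    in the hypotheses become - W after division by their denominators, and the
    prefactors 1 / (S D) and 1 / (S (- D)) make them cancel. *)
Lemma exchange_algebra (Az Aw Az' Aw' Bz Bw Bz' Bw' S D Sa Da Sb Db W Pz Pw qi qj : C) :
  S != 0 -> D != 0 -> Sa != 0 -> Sb != 0 -> Da != 0 -> Db != 0 ->
  Az * Aw' - Aw * Az' = W * (Sa * - Da) ->
  Bz * Bw' - Bw * Bz' = W * (Sb * - Db) ->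
  Az / (S * D) * (Pz * qi) * (Aw' / (Sa * Da) * (Pw * qj)) +
  Bz / (S * - D) * (Pz * qj) * (Bw' / (Sb * Db) * (Pw * qi)) =
  Aw / (S * D) * (Pw * qi) * (Az' / (Sa * Da) * (Pz * qj)) +
  Bw / (S * - D) * (Pw * qj) * (Bz' / (Sb * Db) * (Pz * qi)).
Proof.
move=> hs hd hsa hsb hda hdb e1 e2.
apply/eqP; rewrite -subr_eq0; apply/eqP.
transitivity (Pz * Pw * qi * qj / (S * D) * (
  (W * (Sa * - Da)) / (Sa * Da) - (W * (Sb * - Db)) / (Sb * Db))).
  by rewrite -e1 -e2; field; rewrite hs hd hsa hsb hda hdb.
by field; rewrite hs hd hsa hsb hda hdb.
Qed.

Lemma kernel_exchange z w x i j a b : i != j ->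
  theta (- sum_xz zs x) != 0 -> theta (x 0 i - x 0 j) != 0 ->
  theta (- (sum_xz zs x + a)) != 0 -> theta (- (sum_xz zs x + b)) != 0 ->
  theta (x 0 j - (x 0 i + a)) != 0 -> theta (x 0 i - (x 0 j + b)) != 0 ->
  kernel z x i * kernel w (translate i a x) j + kernel z x j * kernel w (translate j b x) i =
  kernel w x i * kernel z (translate i a x) j + kernel w x j * kernel z (translate j b x) i.
Proof.
move=> ij hs hd hsa hsb hda hdb; have ji : j != i by rewrite eq_sym.
have swap (F : 'I_n -> C) : \prod_(k < n | (k != j) && (k != i)) F k =
    \prod_(k < n | (k != i) && (k != j)) F k.
  by apply: eq_bigl => k; rewrite andbC.
rewrite (kernel_split z x ij) (kernel_split w x ij).
rewrite (kernel_split z x ji) (kernel_split w x ji).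
rewrite (kernel_translate_split z x a ij) (kernel_translate_split w x a ij).
rewrite (kernel_translate_split z x b ji) (kernel_translate_split w x b ji).
rewrite !swap !prodf_div.
have -> : theta (x 0 j - x 0 i) = - theta (x 0 i - x 0 j).
  by rewrite -theta_opp// opprB.
apply: (exchange_algebra _ _ _ _ hs hd hsa hsb hda hdb).
  exact: theta_exchange.
rewrite theta_exchange; congr (theta _ * theta _ * _); ring.
Qed.

(** For two different indices the terms of the composition agree only after both
    orders of the two steps are added, so the double sum over pairs of steps is
    symmetrized before comparing. *)
Lemma T_S1_commute_at z w f x :
  (forall i j o o', i != j ->
    kernel z x i * kernel w (translate i (step o) x) j +
    kernel z x j * kernel w (translate j (step o') x) i =
    kernel w x i * kernel z (translate i (step o) x) j +
    kernel w x j * kernel z (translate j (step o') x) i) ->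
  let T := T_S1 tau eta zs Lam vartheta in T z (T w f) x = T w (T z f) x.
Proof.
move=> exch T.
pose G u v (p q : 'I_n * bool) :=
  kernel u x p.1 * amplitude p.2 (x 0 p.1) *
  (kernel v (translate p.1 (step p.2) x) q.1 *
    amplitude q.2 (translate p.1 (step p.2) x 0 q.1) *
    f (translate q.1 (step q.2) (translate p.1 (step p.2) x))).
have TE u v : T u (T v f) x = \sum_p \sum_q G u v p q.
  rewrite /T T_S1E; apply: eq_bigr => p _; rewrite T_S1E mulr_sumr.
  by apply: eq_bigr.
have sym p q : G z w p q + G z w q p = G w z p q + G w z q p.
  case: p q => [i o] [j o']; rewrite /G /=; have [<-|ij] := eqVneq i j.
    have regroup (k1 k2 k3 k4 A B F : C) : k1 * k2 = k3 * k4 ->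
        k1 * A * (k2 * B * F) = k3 * A * (k4 * B * F).
      move=> e; transitivity (k1 * k2 * (A * B * F)); first by ring.
      by rewrite e; ring.
    congr (_ + _); first exact: regroup (kernel_same z w x i (step o)).
    exact: regroup (kernel_same z w x i (step o')).
  have ji : j != i by rewrite eq_sym.
  rewrite !(translate_other _ _ ij) !(translate_other _ _ ji).
  rewrite (translateC i j (step o)).
  set A := amplitude o _; set B := amplitude o' _; set F := f _.
  have := exch i j o o' ij.
  set k1 := kernel z x i; set k2 := kernel w _ j; set k3 := kernel z x j.
  set k4 := kernel w _ i; set k5 := kernel w x i; set k6 := kernel z _ j.
  set k7 := kernel w x j; set k8 := kernel z _ i => e.
  transitivity ((k1 * k2 + k3 * k4) * (A * B * F)); first by ring.
  by rewrite e; ring.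
rewrite !TE; apply: (mulfI (_ : (2 : C) != 0)); first by rewrite pnatr_eq0.
have dbl u v : 2 * (\sum_p \sum_q G u v p q) =
    \sum_p \sum_q (G u v p q + G u v q p).
  rewrite mulrDl mul1r [in X in _ + X]exchange_big -big_split.
  by apply: eq_bigr => p _; rewrite -big_split.
by rewrite !dbl; apply: eq_bigr => p _; apply: eq_bigr => q _; exact: sym.
Qed.

End SeparatedOperators.

(** * Generic points *)

Section GenericPoints.
Context {R : realType} {n : nat}.
Local Notation C := R[i].
Variables (zs : 'I_n -> C).

(** Up to a constant, every denominator in the composition of two operators is
    theta at one of these forms. Attaching the form - s to the diagonal pairs
    imposes no condition when n = 0, where s = 0 and theta(- s) = 0. *)
Definition divisor_form (i j : 'I_n) (x : 'rV[C]_n) : C :=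
  if i == j then - sum_xz zs x else x 0 i - x 0 j.

Lemma divisor_form_continuous i j : continuous (divisor_form i j).
Proof.
have ce k : continuous (fun x : 'rV[C]_n => x 0 k) by exact: coord_continuous.
rewrite /divisor_form; case: eqP => _ x; last first.
  exact: (@cvgB C C _ (nbhs x) _ _ _ _ _ (ce i x) (ce j x)).
have cs : continuous (sum_xz zs).
  rewrite /sum_xz; apply: (@continuous_big C 'I_n +%R 0 xpredT) => [|k _ y].
    exact: add_continuous.
  exact: (@cvgD C C _ (nbhs y) _ _ _ _ _ (ce k y) (cvg_cst _)).
exact: (@cvgN C C _ (nbhs x) _ _ _ (cs x)).
Qed.

Lemma divisor_form_slope i j : exists v, forall x t,
  divisor_form i j (x + t *: v) = divisor_form i j x + t.
Proof.
exists ((if i == j then -1 else 1) *: delta_mx 0 i) => x t.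
rewrite scalerA -/(translate i _ x) /divisor_form; case: eqVneq => [_|ij].
  by rewrite sum_translate; ring.
by rewrite translate_same translate_other 1?eq_sym//; ring.
Qed.

End GenericPoints.

Theorem proposition3p2 (R : realType) (n : nat) (tau eta : R[i])
    (zs : 'I_n -> R[i]) (Lam : 'I_n -> nat)
    (tau_gt0 : 0 < complex.Im tau) (zs_inj : injective zs)
    (vartheta z w : R[i]) (f : 'rV[R[i]]_n -> R[i]) (f_mero : meromorphic f) :
  let T := T_S1 tau eta zs Lam vartheta in
  mero_eq (T z (T w f)) (T w (T z f)).
Proof.
(* [None] gives the denominators of the operator applied last, [Some o] those of
   the other one, evaluated after the step [o]. *)
pose shift (o : option bool) := oapp (step eta) 0 o.
pose P (q : 'I_n * 'I_n * option bool) : set 'rV[R[i]]_n :=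
  [set x | theta tau (divisor_form zs q.1.1 q.1.2 x - shift q.2) != 0].
have [|oD dD] := @open_dense_fin _ _ P.
  move=> [[i j] o]; have [v hv] := divisor_form_slope zs i j.
  apply: (theta_neq0_open_dense tau_gt0 (v := v)) => [|x t].
    move=> x; exact: (@cvgB _ R[i] _ (nbhs x) _ _ _ _ _
      (@divisor_form_continuous _ _ zs i j x) (cvg_cst _)).
  by rewrite hv addrAC.
exists [set x | forall q, P q x]; split; [exact: oD | exact: dD | move=> x Dx].
apply: T_S1_commute_at => i j o o' ij.
have ji : (j == i) = false by rewrite eq_sym (negbTE ij).
have diag p : theta tau (- sum_xz zs x - shift p) != 0.
  by have := Dx (i, i, p); rewrite /P /= /divisor_form eqxx.
have off p : theta tau (x 0 i - x 0 j - shift p) != 0.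
  by have := Dx (i, j, p); rewrite /P /= /divisor_form (negbTE ij).
have off' p : theta tau (x 0 j - x 0 i - shift p) != 0.
  by have := Dx (j, i, p); rewrite /P /= /divisor_form ji.
apply: kernel_exchange; [exact: tau_gt0 | exact: ij | | | | | |].
- by have := diag None; rewrite subr0.
- by have := off None; rewrite subr0.
- by have := diag (Some o); rewrite -opprD.
- by have := diag (Some o'); rewrite -opprD.
- by have := off' (Some o); rewrite -addrA -opprD.
- by have := off (Some o'); rewrite -addrA -opprD.
Qed.
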